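(* Let $\lambda\in\mathbb{C}$ and $\mu>0$. Let $f \in \mathcal{S}_{\mathcal{AP}}^{*}$, $f(z)=z+\sum_{n=2}^{\infty}a_nz^n$, and let $F_{\lambda,\mu}(f)=|a_3-\lambda a_2^2|-\mu|a_2|$. Then $F_{\lambda,\mu}(f) \le U_{\mathcal{AP}}(\lambda,\mu)$, where $$U_{\mathcal{AP}}(\lambda,\mu) = \begin{cases} \dfrac{9}{4} \left| \lambda - \dfrac{25}{36} \right| - \dfrac{3\mu}{2}, & \text{if } \left| \lambda - \dfrac{25}{36} \right| \ge \dfrac{1}{3} + \dfrac{2\mu}{3}, \\[3mm] \dfrac{3}{4}, & \text{if } \left| \lambda - \dfrac{25}{36} \right| < \dfrac{1}{3} + \dfrac{2\mu}{3}. \end{cases}$$ These estimates are sharp, i.e. for every such $\lambda,\mu$ there is a function in $\mathcal{S}_{\mathcal{AP}}^{*}$ for which equality holds.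
   Context: Let $\mathbb{D}=\{z\in\mathbb{C}:|z|<1\}$, and let $\mathcal{A}$ be the class of analytic functions $f$ on $\mathbb{D}$ normalized by $f(0)=0$, $f'(0)=1$, written $f(z)=z+\sum_{n=2}^{\infty}a_nz^n$. For analytic $f,g$ on $\mathbb{D}$, $f\prec g$ (subordination) means that there is an analytic function $\omega$ on $\mathbb{D}$ with $\omega(0)=0$ and $|\omega(z)|<1$ (a Schwarz function) such that $f(z)=g(\omega(z))$ for $z\in\mathbb{D}$. The class $\mathcal{S}_{\mathcal{AP}}^{*}$ consists of all $f\in\mathcal{A}$ with $$\frac{zf'(z)}{f(z)}\prec\psi_{\mathcal{AP}}(z):=e^{z}\sqrt{1+z},\quad z\in\mathbb{D},$$ where the square root is the principal branch (value $1$ at $z=0$). *)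

(* Defs.v *)
From Stdlib Require Import Reals Lra.
From Coquelicot Require Import Coquelicot.
Open Scope R_scope.

Definition in_disk (z : C) : Prop := Cmod z < 1.

(* Functions on the disk are total maps [C -> C]; only their values on the
   (open) disk matter.  Here [ex_derive] is differentiability over the field C. *)
Definition analytic_on_disk (f : C -> C) : Prop :=
  forall z : C, in_disk z -> ex_derive (K := C_AbsRing) (V := C_NormedModule) f z.

Definition class_A (f : C -> C) : Prop :=
  analytic_on_disk f /\ f (RtoC 0) = RtoC 0 /\ C_derive f (RtoC 0) = RtoC 1.

(* f(z) = z + sum_{n >= 2} a_n z^n on the disk; [a 0] and [a 1] are irrelevant. *)
Definition expansion (f : C -> C) (a : nat -> C) : Prop :=
  forall z : C, in_disk z ->
    is_series (K := C_AbsRing) (V := C_NormedModule)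
      (fun n : nat => (a (n + 2)%nat * z ^ (n + 2))%C) (f z - z)%C.

Definition schwarz_function (w : C -> C) : Prop :=
  analytic_on_disk w /\ w (RtoC 0) = RtoC 0 /\
  forall z : C, in_disk z -> Cmod (w z) < 1.

Definition subordinate (f g : C -> C) : Prop :=
  exists w : C -> C, schwarz_function w /\
    forall z : C, in_disk z -> f z = g (w z).

Definition Cexp (z : C) : C :=
  (exp (Re z) * cos (Im z), exp (Re z) * sin (Im z)).

(* Principal branch, in terms of the real and imaginary parts. *)
Definition Csqrt (z : C) : C :=
  (sqrt ((Cmod z + Re z) / 2),
   (if Rle_dec 0 (Im z) then 1 else -1) * sqrt ((Cmod z - Re z) / 2)).

Lemma Csqrt_sqr (z : C) : (Csqrt z * Csqrt z)%C = z.
Proof.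
destruct z as [x y]; unfold Csqrt, Cmult, Re, Im; simpl.
assert (Hm : Cmod (x, y) * Cmod (x, y) = x * x + y * y).
{ unfold Cmod; simpl; rewrite sqrt_sqrt; [ring | nra]. }
pose proof (Cmod_ge_0 (x, y)) as H0.
set (m := Cmod (x, y)) in *.
assert (Hp : 0 <= (m + x) / 2) by nra.
assert (Hn : 0 <= (m - x) / 2) by nra.
assert (Hpn : sqrt ((m + x) / 2) * sqrt ((m - x) / 2) = Rabs y / 2).
{ rewrite <- sqrt_mult by assumption.
  replace ((m + x) / 2 * ((m - x) / 2)) with (Rsqr (y / 2))
    by (unfold Rsqr; nra).
  rewrite sqrt_Rsqr_abs; unfold Rdiv; rewrite Rabs_mult, (Rabs_pos_eq (/ 2)); lra. }
pose proof (sqrt_sqrt _ Hp) as Sp; pose proof (sqrt_sqrt _ Hn) as Sn.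
set (s := sqrt ((m + x) / 2)) in *; set (t := sqrt ((m - x) / 2)) in *.
destruct (Rle_dec 0 y) as [Hy | Hy].
- rewrite Rabs_pos_eq in Hpn by assumption; f_equal; lra.
- rewrite Rabs_left in Hpn by lra; f_equal; lra.
Qed.

Lemma Csqrt_Re_ge0 (z : C) : 0 <= Re (Csqrt z).
Proof. apply sqrt_pos. Qed.

Definition psi_AP (z : C) : C := (Cexp z * Csqrt (RtoC 1 + z))%C.

(* z f'(z) / f(z), with its removable singularity at 0 filled in
   (the value is 1 when f is in [class_A]). *)
Definition starlike_quotient (f : C -> C) (z : C) : C :=
  if Ceq_dec z (RtoC 0) then RtoC 1 else (z * C_derive f z / f z)%C.

(* The nonvanishing condition makes the quotient well defined, division being
   total in Coquelicot. *)
Definition class_S_AP (f : C -> C) : Prop :=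
  class_A f /\
  (forall z : C, in_disk z -> z <> RtoC 0 -> f z <> RtoC 0) /\
  subordinate (starlike_quotient f) psi_AP.

Definition F_functional (lambda : C) (mu : R) (a : nat -> C) : R :=
  Cmod (a 3%nat - lambda * a 2%nat ^ 2)%C - mu * Cmod (a 2%nat).

Definition U_AP (lambda : C) (mu : R) : R :=
  if Rle_dec (1 / 3 + 2 * mu / 3) (Cmod (lambda - RtoC (25 / 36))%C)
  then 9 / 4 * Cmod (lambda - RtoC (25 / 36))%C - 3 * mu / 2
  else 3 / 4.

(* Main.v *)
(* Write [w] for the Schwarz function of [f], with [w(z) = c1 z + c2 z^2 + ...].
   Comparing coefficients in [z f'(z)/f(z) = psi(w(z))] gives [a2 = 3/2 c1] and
   [a3 = 25/16 c1^2 + 3/4 c2], so the bound follows from [|c2| <= 1 - |c1|^2] and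
   convexity in [|c1|]; equality holds for [w(z) = z] and [w(z) = z^2].

   Cauchy's theorem is only needed for mean values over circles centred at 0,
   and only for functions with continuous derivative, where it follows from the
   Cauchy-Riemann equations and differentiation under the integral.  That [w']
   is continuous is read off the power series of [f].  The coefficient inequality
   is Bessel's inequality for [(w(z)/z) (1 + beta z)] with a suitable [beta].

   The power series needed for sharpness all come from one source: [u' = p u],
   [u(0) = 1] has a power series solution whenever [p] is a power series.  It is
   used for [psi] itself, whose logarithmic derivative is
   [1 + 1/(2(1 + z))], and for [f(z)/z]. *)

Require Import Defs.
From Stdlib Require Import Reals Lra Lia.
From Coquelicot Require Import Coquelicot.
Open Scope R_scope.

(** * Complex derivatives and continuity *)

(** The Schwarz function is only given as complex differentiable, so no Taylor series of it is at
    hand for comparing coefficients. Its first two coefficients are read off a factorization w(z) =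
    z (c1 + z k(z)) with k merely continuous at 0 and continuously differentiable away from 0; c2 is
    the value k(0). The mean value argument is shaped to accept exactly this regularity: a limit at
    the centre and a continuous derivative on the punctured disk. With l = |lambda - 25/36| and t =
    |c1|, the formulas for a2 and a3 bound the functional by 3/4 + (9/4 l - 3/4) t^2 - 3/2 mu t. The
    constant 25/36 is the quotient of 25/16 by 9/4. The two branches of [U_AP] are the values of
    this bound at t = 1 and t = 0; they agree at l = 1/3 + 2 mu / 3, which is the threshold. If the
    quadratic coefficient is negative the bound is decreasing rather than convex, and t = 0 still
    gives the maximum. *)

Definition Ccontinuous (f : C -> C) (z : C) : Prop :=
  continuous (T := AbsRing_UniformSpace C_AbsRing)
    (U := AbsRing_UniformSpace C_AbsRing) f z.

Definition is_Cderive (f : C -> C) (z l : C) : Prop :=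
  is_derive (K := C_AbsRing) (V := C_NormedModule) f z l.

(** The two structures on the codomain have different uniformities, the product one and the one
    given by [Cmod] disks, but the same norm, and differentiability sees only the norm. The
    definitions use the first structure, the product and chain rules the second. *)
Lemma is_Cderive_abs (f : C -> C) (z l : C) :
  is_Cderive f z l <->
  is_derive (K := C_AbsRing) (V := AbsRing_NormedModule C_AbsRing) f z l.
Proof. split; intros [[H1 H2 H3] H4]; split; try split; assumption. Qed.

Lemma Ccontinuous_eps (f : C -> C) (z : C) :
  Ccontinuous f z <->
  forall eps, 0 < eps -> exists del, 0 < del /\
    forall y, Cmod (y - z) < del -> Cmod (f y - f z) < eps.
Proof.
split.
- intros H eps Heps.
  specialize (H _ (locally_ball (T := AbsRing_UniformSpace C_AbsRing) (f z)
    (mkposreal eps Heps))).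
  destruct H as [d Hd]; exists d; split; [apply cond_pos|].
  intros y Hy; exact (Hd y Hy).
- intros H P [e He].
  destruct (H e (cond_pos e)) as [d [Hd1 Hd2]].
  exists (mkposreal d Hd1); intros y Hy; apply He; exact (Hd2 y Hy).
Qed.

Lemma is_Cderive_eps (f : C -> C) (z l : C) :
  is_Cderive f z l <->
  forall eps, 0 < eps -> exists del, 0 < del /\
    forall y, Cmod (y - z) < del ->
      Cmod (f y - f z - l * (y - z)) <= eps * Cmod (y - z).
Proof.
rewrite is_Cderive_abs; split.
- intros [_ H] eps Heps.
  specialize (H z (fun P HP => HP) (mkposreal eps Heps)).
  destruct H as [d Hd]; exists d; split; [apply cond_pos|].
  intros y Hy; specialize (Hd y Hy).
  replace (f y - f z - l * (y - z))%C with (f y - f z - (y - z) * l)%C by ring.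
  exact Hd.
- intros H; split; [apply is_linear_scal_l|].
  intros x Hx.
  pose proof (is_filter_lim_locally_unique
    (V := AbsRing_NormedModule C_AbsRing) z x Hx) as E; subst x.
  intros eps; destruct (H eps (cond_pos eps)) as [d [Hd1 Hd2]].
  exists (mkposreal d Hd1); intros y Hy; specialize (Hd2 y Hy).
  replace (f y - f z - l * (y - z))%C with (f y - f z - (y - z) * l)%C in Hd2
    by ring.
  exact Hd2.
Qed.

Lemma Ccontinuous_const (c z : C) : Ccontinuous (fun _ => c) z.
Proof. apply (continuous_const (U := AbsRing_UniformSpace C_AbsRing)). Qed.

Lemma Ccontinuous_id (z : C) : Ccontinuous (fun y => y) z.
Proof. apply (continuous_id (U := AbsRing_UniformSpace C_AbsRing)). Qed.

Lemma Ccontinuous_plus (f g : C -> C) (z : C) :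
  Ccontinuous f z -> Ccontinuous g z -> Ccontinuous (fun y => (f y + g y)%C) z.
Proof.
intros Hf Hg.
exact (continuous_plus (U := AbsRing_UniformSpace C_AbsRing)
  (V := AbsRing_NormedModule C_AbsRing) f g z Hf Hg).
Qed.

Lemma Ccontinuous_opp (f : C -> C) (z : C) :
  Ccontinuous f z -> Ccontinuous (fun y => (- f y)%C) z.
Proof.
intros Hf.
exact (continuous_opp (U := AbsRing_UniformSpace C_AbsRing)
  (V := AbsRing_NormedModule C_AbsRing) f z Hf).
Qed.

Lemma Ccontinuous_mult (f g : C -> C) (z : C) :
  Ccontinuous f z -> Ccontinuous g z -> Ccontinuous (fun y => (f y * g y)%C) z.
Proof.
intros Hf Hg.
exact (continuous_mult (U := AbsRing_UniformSpace C_AbsRing)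
  (K := C_AbsRing) f g z Hf Hg).
Qed.

Lemma Ccontinuous_comp (f g : C -> C) (z : C) :
  Ccontinuous f z -> Ccontinuous g (f z) -> Ccontinuous (fun y => g (f y)) z.
Proof.
intros Hf Hg.
exact (continuous_comp (U := AbsRing_UniformSpace C_AbsRing)
  (V := AbsRing_UniformSpace C_AbsRing) (W := AbsRing_UniformSpace C_AbsRing)
  f g z Hf Hg).
Qed.

Lemma is_Cderive_eq (f : C -> C) (z l l' : C) :
  is_Cderive f z l -> l = l' -> is_Cderive f z l'.
Proof. intros H <-; exact H. Qed.

Lemma is_Cderive_const (c z : C) : is_Cderive (fun _ => c) z 0.
Proof. apply is_Cderive_abs, @is_derive_const. Qed.

Lemma is_Cderive_id (z : C) : is_Cderive (fun y => y) z 1.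
Proof. apply is_Cderive_abs, @is_derive_id. Qed.

Lemma is_Cderive_plus (f g : C -> C) (z l m : C) :
  is_Cderive f z l -> is_Cderive g z m ->
  is_Cderive (fun y => (f y + g y)%C) z (l + m).
Proof.
rewrite !is_Cderive_abs.
apply (is_derive_plus (V := AbsRing_NormedModule C_AbsRing)).
Qed.

Lemma is_Cderive_mult (f g : C -> C) (z l m : C) :
  is_Cderive f z l -> is_Cderive g z m ->
  is_Cderive (fun y => (f y * g y)%C) z (l * g z + f z * m).
Proof.
rewrite !is_Cderive_abs; intros Hf Hg.
apply (is_derive_mult (K := C_AbsRing) f g z l m Hf Hg Cmult_comm).
Qed.

Lemma is_Cderive_comp (f g : C -> C) (z l m : C) :
  is_Cderive f z l -> is_Cderive g (f z) m ->
  is_Cderive (fun y => g (f y)) z (m * l).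
Proof.
rewrite !is_Cderive_abs; intros Hf Hg.
replace (m * l)%C with (l * m)%C by ring.
exact (is_derive_comp (K := C_AbsRing) (V := AbsRing_NormedModule C_AbsRing)
  g f z m l Hg Hf).
Qed.

Lemma is_Cderive_continuous (f : C -> C) (z l : C) :
  is_Cderive f z l -> Ccontinuous f z.
Proof.
rewrite is_Cderive_abs; intros H.
apply (ex_derive_continuous (V := AbsRing_NormedModule C_AbsRing)).
exists l; exact H.
Qed.

Lemma is_Cderive_ext_loc (f g : C -> C) (z l : C) (r : R) :
  0 < r -> (forall y, Cmod (y - z) < r -> f y = g y) ->
  is_Cderive f z l -> is_Cderive g z l.
Proof.
intros Hr H; rewrite !is_Cderive_eps; intros Hf eps Heps.
destruct (Hf eps Heps) as [d [Hd1 Hd2]].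
exists (Rmin d r); split; [apply Rmin_glb_lt; assumption|].
intros y Hy.
rewrite <- !H.
- apply Hd2; eapply Rlt_le_trans; [exact Hy | apply Rmin_l].
- replace (z - z)%C with (RtoC 0) by ring; rewrite Cmod_0; exact Hr.
- eapply Rlt_le_trans; [exact Hy | apply Rmin_r].
Qed.

Lemma is_Cderive_unique (f : C -> C) (z l m : C) :
  is_Cderive f z l -> is_Cderive f z m -> l = m.
Proof.
intros Hl Hm.
rewrite <- (is_C_derive_unique f z l Hl); apply is_C_derive_unique, Hm.
Qed.

(** * Modulus estimates and differentiation of the inverse *)

Lemma Cmod_minus_sym (x y : C) : Cmod (x - y) = Cmod (y - x).
Proof. rewrite <- Cmod_opp; f_equal; ring. Qed.

Lemma Cmod_minus_ge (x y : C) : Cmod x - Cmod y <= Cmod (x - y).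
Proof.
pose proof (Cmod_triangle (x - y) y) as H.
replace (x - y + y)%C with x in H by ring; lra.
Qed.

Lemma Cmod_neq_0 (z : C) : 0 < Cmod z -> z <> 0.
Proof. apply Cmod_gt_0. Qed.

(* From [1/y - 1/z = (z - y)/(y z)] and [|y| >= |z|/2] near [z]. *)
Lemma Ccontinuous_Cinv (z : C) : z <> 0 -> Ccontinuous Cinv z.
Proof.
intros Hz; apply Ccontinuous_eps; intros eps Heps.
assert (H0 : 0 < Cmod z) by (apply Cmod_gt_0; exact Hz).
exists (Rmin (Cmod z / 2) (eps * (Cmod z * Cmod z / 2))); split.
{ apply Rmin_glb_lt; [lra|]; apply Rmult_lt_0_compat; nra. }
intros y Hy.
assert (H1 : Cmod (y - z) < Cmod z / 2)
  by (eapply Rlt_le_trans; [exact Hy | apply Rmin_l]).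
assert (H2 : Cmod (y - z) < eps * (Cmod z * Cmod z / 2))
  by (eapply Rlt_le_trans; [exact Hy | apply Rmin_r]).
pose proof (Cmod_minus_ge z y) as H3; rewrite Cmod_minus_sym in H3.
assert (Hy0 : y <> 0) by (apply Cmod_neq_0; lra).
replace (/ y - / z)%C with ((z - y) / (y * z))%C by (field; auto).
rewrite Cmod_div by (apply Cmult_neq_0; assumption).
rewrite Cmod_mult, Cmod_minus_sym.
apply Rlt_div_l; [apply Rmult_lt_0_compat; lra|].
eapply Rlt_le_trans; [exact H2|].
apply Rmult_le_compat_l; [lra|]; nra.
Qed.

(** The first-order remainder equals -(1/y - 1/z) (y - z) / z, so continuity of the inverse already
    makes it small compared with y - z. *)
Lemma is_Cderive_Cinv (z : C) : z <> 0 -> is_Cderive Cinv z (- / (z * z)).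
Proof.
intros Hz; apply is_Cderive_eps; intros eps Heps.
pose proof (Ccontinuous_Cinv z Hz) as Hc; rewrite Ccontinuous_eps in Hc.
assert (H0 : 0 < Cmod z) by (apply Cmod_gt_0; exact Hz).
destruct (Hc (eps * Cmod z)) as [d [Hd1 Hd2]]; [nra|].
exists (Rmin d (Cmod z)); split; [apply Rmin_glb_lt; assumption|].
intros y Hy.
assert (H1 : Cmod (y - z) < d)
  by (eapply Rlt_le_trans; [exact Hy | apply Rmin_l]).
assert (H2 : Cmod (y - z) < Cmod z)
  by (eapply Rlt_le_trans; [exact Hy | apply Rmin_r]).
pose proof (Cmod_minus_ge z y) as H3; rewrite Cmod_minus_sym in H3.
assert (Hy0 : y <> 0) by (apply Cmod_neq_0; lra).
replace (/ y - / z - - / (z * z) * (y - z))%C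
  with (- (/ y - / z) * / z * (y - z))%C by (field; auto).
rewrite !Cmod_mult, Cmod_opp, Cmod_inv by assumption.
apply Rmult_le_compat_r; [apply Cmod_ge_0|].
specialize (Hd2 y H1).
apply Rle_div_l; lra.
Qed.

Lemma Ccontinuous_inv (f : C -> C) (z : C) :
  Ccontinuous f z -> f z <> 0 -> Ccontinuous (fun y => (/ f y)%C) z.
Proof.
intros Hf Hz; apply Ccontinuous_comp; [exact Hf | apply Ccontinuous_Cinv, Hz].
Qed.

Lemma is_Cderive_inv (f : C -> C) (z l : C) :
  is_Cderive f z l -> f z <> 0 ->
  is_Cderive (fun y => (/ f y)%C) z (- / (f z * f z) * l).
Proof.
intros Hf Hz; apply is_Cderive_comp; [exact Hf | apply is_Cderive_Cinv, Hz].
Qed.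

(** Only sums, products and inverses are recognized, so functions to be differentiated are written
    below without subtraction or division of varying terms. Nonvanishing of denominators is left as
    a goal. *)
Ltac Cderive_rules :=
  repeat match goal with
  | |- is_Cderive (fun _ => ?c) _ _ => apply (is_Cderive_const c)
  | |- is_Cderive (fun y => y) _ _ => apply is_Cderive_id
  | |- is_Cderive (fun y => Cplus (@?f y) (@?g y)) _ _ =>
      apply (is_Cderive_plus f g)
  | |- is_Cderive (fun y => Cmult (@?f y) (@?g y)) _ _ =>
      apply (is_Cderive_mult f g)
  | |- is_Cderive (fun y => Cinv (@?f y)) _ _ => apply (is_Cderive_inv f)
  | H : is_Cderive ?f ?z _ |- is_Cderive ?f ?z _ => exact H
  | H : is_Cderive ?f ?z _ |- is_Cderive (fun y => ?f y) ?z _ => exact H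
  end.

Ltac Ccontinuous_rules :=
  repeat match goal with
  | |- Ccontinuous (fun _ => ?c) _ => apply (Ccontinuous_const c)
  | |- Ccontinuous (fun y => y) _ => apply Ccontinuous_id
  | |- Ccontinuous (fun y => Cplus (@?f y) (@?g y)) _ =>
      apply (Ccontinuous_plus f g)
  | |- Ccontinuous (fun y => Cmult (@?f y) (@?g y)) _ =>
      apply (Ccontinuous_mult f g)
  | |- Ccontinuous (fun y => Copp (@?f y)) _ => apply (Ccontinuous_opp f)
  | |- Ccontinuous (fun y => Cinv (@?f y)) _ => apply (Ccontinuous_inv f)
  | H : Ccontinuous ?f ?z |- Ccontinuous ?f ?z => exact H
  | H : Ccontinuous ?f ?z |- Ccontinuous (fun y => ?f y) ?z => exact H
  end.

(** * The disk, and complex derivatives along real curves *)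

Lemma in_disk_open (z : C) : in_disk z ->
  exists r, 0 < r /\ forall y, Cmod (y - z) < r -> in_disk y.
Proof.
unfold in_disk; intros H; exists (1 - Cmod z); split; [lra|].
intros y Hy; pose proof (Cmod_minus_ge y z); lra.
Qed.

Lemma in_disk_0 : in_disk 0.
Proof. unfold in_disk; rewrite Cmod_0; lra. Qed.

Lemma Cmod_le_sum (a b : R) : Cmod (a, b) <= Rabs a + Rabs b.
Proof.
replace (a, b) with (RtoC a + Ci * RtoC b)%C
  by (unfold Ci, RtoC, Cplus, Cmult; simpl; f_equal; ring).
eapply Rle_trans; [apply Cmod_triangle|].
rewrite Cmod_mult, Cmod_Ci, !Cmod_R; lra.
Qed.

(** The chain rule along a plane curve. Applied to a ray and to a circle it yields the
    Cauchy-Riemann equations in polar form; applied to a segment it gives constancy when the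
    derivative vanishes. *)
Lemma is_derive_curve (G : C -> C) (x y : R -> R) (u dx dy : R) (l : C) :
  is_Cderive G (x u, y u) l -> is_derive x u dx -> is_derive y u dy ->
  is_derive (fun s => Re (G (x s, y s))) u (Re (l * (dx, dy))) /\
  is_derive (fun s => Im (G (x s, y s))) u (Im (l * (dx, dy))).
Proof.
intros HG Hx Hy.
rewrite is_Cderive_eps in HG; rewrite is_derive_Reals in Hx, Hy.
assert (K : forall eps, 0 < eps -> exists del : posreal, forall h, h <> 0 ->
  Rabs h < del -> Cmod (G (x (u + h), y (u + h)) - G (x u, y u)
     - h * (l * (dx, dy))) <= eps * Rabs h).
{ intros eps Heps.
  (* [k] bounds the difference quotient of the curve once each component is within 1 of its limit,
     and [m] bounds |l|. One half of eps pays for the remainder of [G], the other for the remainder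
     of the curve multiplied by [l]. *)
  set (k := Rabs dx + Rabs dy + 2).
  assert (Hk : 2 <= k)
    by (unfold k; pose proof (Rabs_pos dx); pose proof (Rabs_pos dy); lra).
  set (m := Cmod l + 1).
  assert (Hm : 1 <= m) by (unfold m; pose proof (Cmod_ge_0 l); lra).
  destruct (HG (eps / (2 * k))) as [d [Hd1 Hd2]].
  { apply Rdiv_lt_0_compat; lra. }
  set (e1 := Rmin 1 (eps / (4 * m))).
  assert (He1 : 0 < e1)
    by (apply Rmin_glb_lt; [lra | apply Rdiv_lt_0_compat; lra]).
  destruct (Hx e1 He1) as [d1 Hd3]; destruct (Hy e1 He1) as [d2 Hd4].
  assert (Hd : 0 < Rmin (Rmin d1 d2) (d / k)).
  { repeat apply Rmin_glb_lt; try apply cond_pos; apply Rdiv_lt_0_compat; lra. }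
  exists (mkposreal _ Hd); simpl; intros h Hh0 Hh.
  assert (H1 : Rabs h < d1).
  { eapply Rlt_le_trans; [exact Hh|].
    eapply Rle_trans; [apply Rmin_l | apply Rmin_l]. }
  assert (H2 : Rabs h < d2).
  { eapply Rlt_le_trans; [exact Hh|].
    eapply Rle_trans; [apply Rmin_l | apply Rmin_r]. }
  assert (H3 : Rabs h * k < d).
  { apply Rlt_div_r; [lra|]; eapply Rlt_le_trans; [exact Hh | apply Rmin_r]. }
  specialize (Hd3 h Hh0 H1); specialize (Hd4 h Hh0 H2).
  assert (Hp : 0 < Rabs h) by (apply Rabs_pos_lt; exact Hh0).
  set (ex := (x (u + h) - x u) / h - dx) in *.
  set (ey := (y (u + h) - y u) / h - dy) in *.
  assert (Ex : x (u + h) = x u + h * (dx + ex)) by (unfold ex; field; auto).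
  assert (Ey : y (u + h) = y u + h * (dy + ey)) by (unfold ey; field; auto).
  rewrite Ex, Ey.
  assert (He1' : e1 <= 1) by apply Rmin_l.
  assert (He1'' : e1 * (4 * m) <= eps).
  { apply Rle_div_r; [lra | apply Rmin_r]. }
  assert (Hdiff : (((x u + h * (dx + ex))%R, (y u + h * (dy + ey))%R)
      - (x u, y u))%C = (h * ((dx, dy) + (ex, ey)))%C).
  { unfold Cminus, Cplus, Cmult, Copp, RtoC; simpl; f_equal; ring. }
  specialize (Hd2 (x u + h * (dx + ex), y u + h * (dy + ey))).
  rewrite Hdiff in Hd2.
  assert (Hn : Cmod (h * ((dx, dy) + (ex, ey))) <= Rabs h * k).
  { rewrite Cmod_mult, Cmod_R; apply Rmult_le_compat_l; [lra|].
    eapply Rle_trans; [apply Cmod_triangle|].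
    pose proof (Cmod_le_sum dx dy); pose proof (Cmod_le_sum ex ey).
    unfold k; lra. }
  specialize (Hd2 (Rle_lt_trans _ _ _ Hn H3)).
  match goal with |- Cmod (?A - ?B - _) <= _ =>
    replace (A - B - h * (l * (dx, dy)))%C with
     ((A - B - l * (h * ((dx, dy) + (ex, ey)))) + h * (l * (ex, ey)))%C by ring
  end.
  eapply Rle_trans; [apply Cmod_triangle|].
  assert (H5 : Cmod (h * (l * (ex, ey))) <= eps / 2 * Rabs h).
  { rewrite !Cmod_mult, Cmod_R.
    pose proof (Cmod_le_sum ex ey) as H6; pose proof (Cmod_ge_0 l) as H7.
    pose proof (Cmod_ge_0 (ex, ey)) as H8.
    assert (Cmod l * Cmod (ex, ey) <= m * (2 * e1)).
    { apply Rmult_le_compat; try assumption; unfold m; lra. }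
    rewrite (Rmult_comm _ (Rabs h)); apply Rmult_le_compat_l; lra. }
  assert (H6 : eps / (2 * k) * Cmod (h * ((dx, dy) + (ex, ey)))
    <= eps / 2 * Rabs h).
  { replace (eps / 2 * Rabs h) with (eps / (2 * k) * (Rabs h * k))
      by (field; lra).
    apply Rmult_le_compat_l; [|exact Hn].
    apply Rlt_le, Rdiv_lt_0_compat; lra. }
  lra. }
assert (Him : forall c : C, Rabs (Im c) <= Cmod c).
{ intros c; eapply Rle_trans; [apply Rmax_r | apply Rmax_Cmod]. }
(* The real derivative demands a strict inequality, hence eps / 2. *)
split; apply is_derive_Reals; intros eps Heps;
  (destruct (K (eps / 2)) as [d Hd]; [lra|]);
  exists d; intros h Hh0 Hh; specialize (Hd h Hh0 Hh);
  assert (Hp : 0 < Rabs h) by (apply Rabs_pos_lt; exact Hh0);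
  match type of Hd with Cmod ?c <= _ =>
    pose proof (re_le_Cmod c) as H1; pose proof (Him c) as H2 end.
- match goal with |- Rabs ?e < _ => replace e with
   (Re (G (x (u + h), y (u + h)) - G (x u, y u) - h * (l * (dx, dy))) / h)
   by (unfold Re, Im; simpl; field; exact Hh0) end.
  unfold Rdiv; rewrite Rabs_mult, Rabs_inv; apply Rlt_div_l; nra.
- match goal with |- Rabs ?e < _ => replace e with
   (Im (G (x (u + h), y (u + h)) - G (x u, y u) - h * (l * (dx, dy))) / h)
   by (unfold Re, Im; simpl; field; exact Hh0) end.
  unfold Rdiv; rewrite Rabs_mult, Rabs_inv; apply Rlt_div_l; nra.
Qed.

(** Real and imaginary part have derivative zero along the segment from 0 to z, which stays in the
    disk. *)
Lemma Cderive_0_const (F : C -> C) :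
  (forall z, in_disk z -> is_Cderive F z 0) ->
  forall z, in_disk z -> F z = F 0.
Proof.
intros H z Hz.
assert (D : forall t, 0 <= t <= 1 ->
  is_derive (fun s => Re (F (s * Re z, s * Im z))) t 0 /\
  is_derive (fun s => Im (F (s * Re z, s * Im z))) t 0).
{ intros t Ht.
  assert (E : (t * Re z, t * Im z) = (t * z)%C).
  { unfold RtoC, Cmult, Re, Im; simpl; f_equal; ring. }
  pose proof (is_derive_curve F (fun s => s * Re z) (fun s => s * Im z) t
    (Re z) (Im z) 0) as K.
  replace (Re (0 * (Re z, Im z))) with 0 in K by (unfold Re, Im; simpl; ring).
  replace (Im (0 * (Re z, Im z))) with 0 in K by (unfold Re, Im; simpl; ring).
  apply K; [|auto_derive; [trivial | ring]..].
  rewrite E; apply H; unfold in_disk in *.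
  rewrite Cmod_mult, Cmod_R, Rabs_pos_eq by lra.
  pose proof (Cmod_ge_0 z); nra. }
assert (E1 := eq_is_derive (fun s => Re (F (s * Re z, s * Im z))) 0 1
  (fun t Ht => proj1 (D t Ht)) Rlt_0_1).
assert (E2 := eq_is_derive (fun s => Im (F (s * Re z, s * Im z))) 0 1
  (fun t Ht => proj2 (D t Ht)) Rlt_0_1).
simpl in E1, E2; rewrite !Rmult_0_l, !Rmult_1_l in E1, E2.
destruct z as [a b]; unfold Re, Im, RtoC in *; simpl in *.
destruct (F (a, b)), (F (0, 0)); simpl in *; congruence.
Qed.

(** * Complex series *)

Definition is_Cseries (c : nat -> C) (l : C) : Prop :=
  is_series (K := C_AbsRing) (V := C_NormedModule) c l.

Definition Csum (c : nat -> C) (n : nat) : C :=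
  sum_n (G := C_AbelianMonoid) c n.

Lemma Csum_S (c : nat -> C) (n : nat) : Csum c (S n) = (Csum c n + c (S n))%C.
Proof. exact (sum_Sn (G := C_AbelianMonoid) c n). Qed.

Lemma Csum_0 (c : nat -> C) : Csum c 0 = c 0%nat.
Proof. exact (sum_O (G := C_AbelianMonoid) c). Qed.

Lemma Csum_ext (u v : nat -> C) (n : nat) :
  (forall k, (k <= n)%nat -> u k = v k) -> Csum u n = Csum v n.
Proof. exact (sum_n_ext_loc (G := C_AbelianMonoid) u v n). Qed.

Lemma Csum_mult_l (c : C) (u : nat -> C) (n : nat) :
  Csum (fun k => (c * u k)%C) n = (c * Csum u n)%C.
Proof. exact (sum_n_mult_l (K := C_Ring) c u n). Qed.

Lemma Re_Csum (c : nat -> C) (n : nat) :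
  Re (Csum c n) = sum_n (fun k => Re (c k)) n.
Proof.
induction n as [|n IH]; [now rewrite Csum_0, sum_O|].
rewrite Csum_S, sum_Sn, re_plus, IH; reflexivity.
Qed.

Lemma Im_Csum (c : nat -> C) (n : nat) :
  Im (Csum c n) = sum_n (fun k => Im (c k)) n.
Proof.
induction n as [|n IH]; [now rewrite Csum_0, sum_O|].
rewrite Csum_S, sum_Sn, im_plus, IH; reflexivity.
Qed.

(** Convergence in [C_NormedModule] refers to the product uniformity, whose balls split into
    conditions on the two components. *)
Lemma is_Cseries_components (c : nat -> C) (l : C) :
  is_Cseries c l <->
  is_series (fun n => Re (c n)) (Re l) /\ is_series (fun n => Im (c n)) (Im l).
Proof.
assert (E : forall n, sum_n (G := C_AbelianMonoid) c n =
   (sum_n (fun k => Re (c k)) n, sum_n (fun k => Im (c k)) n)).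
{ intros n; rewrite <- Re_Csum, <- Im_Csum; unfold Re, Im.
  now rewrite <- surjective_pairing. }
split.
- intros H; pose proof (proj1 (filterlim_locally (U := C_UniformSpace) _ _) H)
    as H'.
  split; apply (filterlim_locally (U := R_UniformSpace)); intros eps;
    generalize (H' eps); apply filter_imp; intros n Hn; rewrite E in Hn;
    apply Hn.
- intros [H1 H2]; apply (filterlim_locally (U := C_UniformSpace)); intros eps.
  pose proof (proj1 (filterlim_locally (U := R_UniformSpace) _ _) H1 eps) as K1.
  pose proof (proj1 (filterlim_locally (U := R_UniformSpace) _ _) H2 eps) as K2.
  generalize (filter_and _ _ K1 K2).
  apply filter_imp; intros n Hn; rewrite E; exact Hn.
Qed.

Lemma is_Cseries_unique (c : nat -> C) (l m : C) :
  is_Cseries c l -> is_Cseries c m -> l = m.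
Proof.
apply (filterlim_locally_unique (K := C_AbsRing) (V := C_NormedModule)).
Qed.

Lemma is_Cseries_ext (c d : nat -> C) (l : C) :
  (forall n, c n = d n) -> is_Cseries c l -> is_Cseries d l.
Proof. apply (is_series_ext (K := C_AbsRing) (V := C_NormedModule)). Qed.

Lemma is_Cseries_scal (k : C) (c : nat -> C) (l : C) :
  is_Cseries c l -> is_Cseries (fun n => (k * c n)%C) (k * l).
Proof. apply (is_series_scal (K := C_AbsRing) (V := C_NormedModule)). Qed.

Lemma is_Cseries_plus (c d : nat -> C) (l m : C) :
  is_Cseries c l -> is_Cseries d m ->
  is_Cseries (fun n => (c n + d n)%C) (l + m).
Proof. apply (is_series_plus (K := C_AbsRing) (V := C_NormedModule)). Qed.

Lemma is_Cseries_S (c : nat -> C) (l : C) :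
  is_Cseries c l <-> is_Cseries (fun n => c (S n)) (l - c 0%nat).
Proof.
split; intros H.
- apply (is_series_incr_1 (K := C_AbsRing) (V := C_NormedModule)).
  change (is_Cseries c (l - c 0%nat + c 0%nat)).
  replace (l - c 0%nat + c 0%nat)%C with l by ring; exact H.
- apply (is_series_decr_1 (K := C_AbsRing) (V := C_NormedModule)); exact H.
Qed.

Lemma Im_le_Cmod (c : C) : Rabs (Im c) <= Cmod c.
Proof. eapply Rle_trans; [apply Rmax_r | apply Rmax_Cmod]. Qed.

Lemma Cseries_dominated (c : nat -> C) (b : nat -> R) :
  (forall n, Cmod (c n) <= b n) -> ex_series b -> exists l, is_Cseries c l.
Proof.
intros Hb [B HB].
assert (H1 : ex_series (fun n => Re (c n))).
{ apply (ex_series_le (V := R_CompleteNormedModule) _ b); [|exists B; exact HB].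
  intros n; eapply Rle_trans; [apply re_le_Cmod | apply Hb]. }
assert (H2 : ex_series (fun n => Im (c n))).
{ apply (ex_series_le (V := R_CompleteNormedModule) _ b); [|exists B; exact HB].
  intros n; eapply Rle_trans; [apply Im_le_Cmod | apply Hb]. }
destruct H1 as [l1 H1], H2 as [l2 H2].
exists (l1, l2); apply is_Cseries_components; split; assumption.
Qed.

(** The unimodular factor rotating [l] onto the positive real axis; it turns a modulus into a real
    part. *)
Lemma Cmod_div_unit (l : C) : l <> 0 ->
  Cmod (Cconj l / Cmod l) = 1 /\ (Cconj l / Cmod l * l)%C = RtoC (Cmod l).
Proof.
intros Hl.
assert (H0 : 0 < Cmod l) by (apply Cmod_gt_0; exact Hl).
assert (H1 : RtoC (Cmod l) <> 0).
{ intros E; apply RtoC_inj in E; lra. }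
split.
- rewrite Cmod_div, Cmod_conj, Cmod_R, Rabs_pos_eq by (auto; lra).
  field; lra.
- replace (Cconj l / Cmod l * l)%C with (l * Cconj l / Cmod l)%C
    by (field; exact H1).
  rewrite <- Cmod2_conj; replace (RtoC (Cmod l ^ 2))
    with (RtoC (Cmod l) * RtoC (Cmod l))%C
    by (rewrite <- RtoC_mult; f_equal; ring).
  field; exact H1.
Qed.

(** After the rotation taking [l] to |l|, only the real parts of the terms matter, and these are
    compared with [b] partial sum by partial sum. *)
Lemma Cmod_Cseries_le (c : nat -> C) (b : nat -> R) (l : C) (B : R) :
  (forall n, Cmod (c n) <= b n) -> is_Cseries c l -> is_series b B ->
  Cmod l <= B.
Proof.
intros Hb Hc HB.
destruct (Ceq_dec l 0) as [->|Hl].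
{ rewrite Cmod_0.
  apply (is_lim_seq_le (fun _ => 0) (sum_n b) 0 B);
    [|apply is_lim_seq_const|exact HB].
  intros n; rewrite <- (Rmult_0_r (INR (S n))), <- sum_n_const.
  apply sum_n_m_le; intros k.
  eapply Rle_trans; [apply Cmod_ge_0 | apply Hb]. }
destruct (Cmod_div_unit l Hl) as [U1 U2].
apply (is_Cseries_scal (Cconj l / Cmod l)) in Hc.
rewrite U2, is_Cseries_components in Hc; destruct Hc as [Hc _].
rewrite re_RtoC in Hc.
apply (is_lim_seq_le (sum_n (fun n => Re (Cconj l / Cmod l * c n))) (sum_n b)
  (Cmod l) B); [|exact Hc|exact HB].
intros n; apply sum_n_m_le; intros k.
eapply Rle_trans; [apply Rle_abs|]; eapply Rle_trans; [apply re_le_Cmod|].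
rewrite Cmod_mult, U1, Rmult_1_l; apply Hb.
Qed.

Lemma Cseries_terms_bounded (c : nat -> C) (l : C) :
  is_Cseries c l -> exists M, forall n, Cmod (c n) <= M.
Proof.
intros H.
destruct (filterlim_bounded (K := C_AbsRing) (V := C_NormedModule) (Csum c))
  as [M HM]; [exists l; exact H|].
assert (HM' : forall n, Cmod (Csum c n) <= M) by exact HM.
exists (M + M); intros [|n].
- pose proof (HM' 0%nat) as H0; rewrite Csum_0 in H0.
  pose proof (Cmod_ge_0 (c 0%nat)); lra.
- pose proof (HM' n); pose proof (HM' (S n)) as H1; rewrite Csum_S in H1.
  replace (c (S n)) with ((Csum c n + c (S n)) - Csum c n)%C by ring.
  eapply Rle_trans; [apply Cmod_triangle|]; rewrite Cmod_opp; lra.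
Qed.

(** The Cauchy product, assembled from four real Cauchy products of components. *)
Lemma is_Cseries_mult (a b : nat -> C) (la lb : C) :
  is_Cseries a la -> is_Cseries b lb ->
  ex_series (fun n => Cmod (a n)) -> ex_series (fun n => Cmod (b n)) ->
  is_Cseries (fun n => Csum (fun k => (a k * b (n - k)%nat)%C) n) (la * lb).
Proof.
rewrite !is_Cseries_components; intros [A1 A2] [B1 B2] HA HB.
assert (D : forall (c : nat -> C), ex_series (fun n => Cmod (c n)) ->
  ex_series (fun n => Rabs (Re (c n))) /\ ex_series (fun n => Rabs (Im (c n)))).
{ intros c Hc; split;
  apply (ex_series_le (V := R_CompleteNormedModule) _ (fun n => Cmod (c n)));
  try exact Hc; intros n; (eapply Rle_trans; [apply Req_le, Rabs_Rabsolu|]).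
  apply re_le_Cmod. apply Im_le_Cmod. }
destruct (D a HA) as [A3 A4], (D b HB) as [B3 B4].
assert (S1 : forall (u v : nat -> C) n,
  Re (Csum (fun k => (u k * v k)%C) n) =
  sum_f_R0 (fun k => Re (u k) * Re (v k)) n
  - sum_f_R0 (fun k => Im (u k) * Im (v k)) n).
{ intros u v n; induction n as [|n IH].
  - rewrite Csum_0; simpl; reflexivity.
  - rewrite Csum_S, re_plus, IH, re_mult; simpl; ring. }
assert (S2 : forall (u v : nat -> C) n,
  Im (Csum (fun k => (u k * v k)%C) n) =
  sum_f_R0 (fun k => Re (u k) * Im (v k)) n
  + sum_f_R0 (fun k => Im (u k) * Re (v k)) n).
{ intros u v n; induction n as [|n IH].
  - rewrite Csum_0; simpl; reflexivity.
  - rewrite Csum_S, im_plus, IH, im_mult; simpl; ring. }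
split.
- rewrite re_mult.
  eapply is_series_ext;
    [| apply (is_series_minus (V := R_NormedModule));
       [apply (is_series_mult _ _ _ _ A1 B1 A3 B3)
       |apply (is_series_mult _ _ _ _ A2 B2 A4 B4)]].
  intros n; symmetry; apply (S1 a (fun k => b (n - k)%nat)).
- rewrite im_mult.
  eapply is_series_ext;
    [| apply (is_series_plus (V := R_NormedModule));
       [apply (is_series_mult _ _ _ _ A1 B2 A3 B4)
       |apply (is_series_mult _ _ _ _ A2 B1 A4 B3)]].
  intros n; symmetry; apply (S2 a (fun k => b (n - k)%nat)).
Qed.

(** Domination gives some sum l, and shifting the index gives l - 1 = q l, which determines it. *)
Lemma is_Cseries_geom (q : C) : Cmod q < 1 ->
  is_Cseries (fun n => (q ^ n)%C) (/ (1 - q)).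
Proof.
intros Hq.
destruct (Cseries_dominated (fun n => (q ^ n)%C) (fun n => Cmod q ^ n))
  as [l Hl].
{ intros n; rewrite Cmod_pow; lra. }
{ apply ex_series_geom; rewrite Rabs_pos_eq; [exact Hq | apply Cmod_ge_0]. }
assert (Hq1 : (1 - q)%C <> 0).
{ apply Cmod_neq_0; pose proof (Cmod_minus_ge 1 q) as H.
  rewrite Cmod_1 in H; lra. }
replace (/ (1 - q))%C with l; [exact Hl|].
pose proof (proj1 (is_Cseries_S _ _) Hl) as H1.
pose proof (is_Cseries_scal q _ _ Hl) as H2.
assert (E : (l - q ^ 0 = q * l)%C).
{ apply (is_Cseries_unique _ _ _ H1), H2. }
simpl in E.
replace l with (((l - 1) - q * l + 1) / (1 - q))%C by (field; exact Hq1).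
rewrite E; field; exact Hq1.
Qed.

Lemma is_Cseries_finite (c : nat -> C) (N : nat) :
  (forall n, (N < n)%nat -> c n = 0) -> is_Cseries c (Csum c N).
Proof.
intros H.
apply (filterlim_ext_loc (fun _ => Csum c N)); [|apply filterlim_const].
exists N; intros n Hn; change (Csum c N = Csum c n).
induction Hn as [|n Hn IH]; [reflexivity|].
rewrite Csum_S, H by lia; rewrite IH; ring.
Qed.

(** * Power series on the unit disk *)

(** Radius of convergence at least 1, expressed by bounded terms: a form that is easily checked for
    recursively defined coefficients and survives shifts and factors linear in n. *)
Definition tame (a : nat -> C) : Prop :=
  forall r, 0 < r < 1 -> exists M, forall n, Cmod (a n) * r ^ n <= M.

Definition has_pseries (f : C -> C) (a : nat -> C) : Prop :=
  forall z, in_disk z -> is_Cseries (fun n => (a n * z ^ n)%C) (f z).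

Lemma in_disk_RtoC (r : R) : 0 < r < 1 -> in_disk r.
Proof. intros H; unfold in_disk; rewrite Cmod_R, Rabs_pos_eq; lra. Qed.

Lemma has_pseries_tame (f : C -> C) (a : nat -> C) :
  has_pseries f a -> tame a.
Proof.
intros H r Hr.
destruct (Cseries_terms_bounded _ _ (H r (in_disk_RtoC r Hr))) as [M HM].
exists M; intros n; specialize (HM n).
rewrite Cmod_mult, Cmod_pow, Cmod_R, Rabs_pos_eq in HM by lra; exact HM.
Qed.

Lemma pow_ratio (r s : R) (n : nat) : 0 < s -> r ^ n = s ^ n * (r / s) ^ n.
Proof. intros Hs; rewrite <- Rpow_mult_distr; f_equal; field; lra. Qed.

(** The terms are bounded at the midpoint s of r and 1, so at r they are dominated by a geometric
    series of ratio r / s. *)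
Lemma tame_abs (a : nat -> C) (r : R) :
  tame a -> 0 <= r < 1 -> ex_series (fun n => Cmod (a n) * r ^ n).
Proof.
intros Ha Hr.
destruct (Ha ((1 + r) / 2)) as [M HM]; [lra|].
set (s := (1 + r) / 2) in *.
assert (Hs : 0 < s) by (unfold s; lra).
assert (Hq : 0 <= r / s < 1).
{ split; [apply Rle_div_r; lra | apply Rlt_div_l; unfold s; lra]. }
apply (ex_series_le (V := R_CompleteNormedModule) _
  (fun n => M * (r / s) ^ n)).
- intros n; pose proof (Cmod_ge_0 (a n)) as H0; specialize (HM n).
  pose proof (pow_le r n (proj1 Hr)) as H1.
  eapply Rle_trans; [apply Req_le, Rabs_pos_eq; nra|].
  rewrite (pow_ratio r s n Hs), <- Rmult_assoc.
  apply Rmult_le_compat_r; [apply pow_le; tauto | exact HM].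
- apply (ex_series_scal (V := R_NormedModule) M (fun n => (r / s) ^ n)).
  apply ex_series_geom; rewrite Rabs_pos_eq; tauto.
Qed.

Lemma tame_abs_disk (a : nat -> C) (z : C) :
  tame a -> in_disk z -> ex_series (fun n => Cmod (a n * z ^ n)).
Proof.
intros Ha Hz.
eapply ex_series_ext; [|apply (tame_abs a (Cmod z) Ha)].
- intros n; rewrite Cmod_mult, Cmod_pow; reflexivity.
- split; [apply Cmod_ge_0 | exact Hz].
Qed.

Lemma tame_pseries (a : nat -> C) : tame a -> exists f, has_pseries f a.
Proof.
intros Ha.
exists (fun z => (Series (fun n => Re (a n * z ^ n)),
                  Series (fun n => Im (a n * z ^ n)))).
intros z Hz.
destruct (Cseries_dominated (fun n => (a n * z ^ n)%C)
  (fun n => Cmod (a n * z ^ n))) as [l Hl].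
- intros n; lra.
- apply tame_abs_disk; assumption.
- pose proof (proj1 (is_Cseries_components _ _) Hl) as [H1 H2].
  rewrite (is_series_unique _ _ H1), (is_series_unique _ _ H2).
  unfold Re, Im; rewrite <- surjective_pairing; exact Hl.
Qed.

Lemma tame_S (a : nat -> C) : tame a -> tame (fun n => a (S n)).
Proof.
intros Ha r Hr; destruct (Ha r Hr) as [M HM]; exists (M / r); intros n.
specialize (HM (S n)); simpl in HM; apply (Rle_div_r _ _ r); [lra|].
rewrite Rmult_assoc, (Rmult_comm (r ^ n)); exact HM.
Qed.

(** Each of the n + 1 summands of 1 + x + ... + x^n is at least x^n. This lets a slightly smaller
    radius absorb a factor n + 1. *)
Lemma succ_mul_pow_le (x : R) (n : nat) :
  0 <= x < 1 -> INR (S n) * x ^ n * (1 - x) <= 1 - x ^ S n.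
Proof.
intros Hx; induction n as [|n IH]; [simpl; lra|].
rewrite S_INR; simpl in *.
pose proof (pow_le x n (proj1 Hx)) as H0.
assert (H1 : x ^ n <= 1) by (rewrite <- (pow1 n); apply pow_incr; lra).
assert (0 <= (1 - x) * (1 - x * x ^ n)) by (apply Rmult_le_pos; nra).
nra.
Qed.

Lemma tame_mul_succ (a : nat -> C) :
  tame a -> tame (fun n => (INR (S n) * a n)%C).
Proof.
intros Ha r Hr.
destruct (Ha ((1 + r) / 2)) as [M HM]; [lra|].
set (s := (1 + r) / 2) in *.
assert (Hs : 0 < s) by (unfold s; lra).
assert (Hq : 0 <= r / s < 1).
{ split; [apply Rle_div_r; lra | apply Rlt_div_l; unfold s; lra]. }
exists (M / (1 - r / s)); intros n; specialize (HM n).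
rewrite Cmod_mult, Cmod_R, Rabs_pos_eq by apply pos_INR.
rewrite (pow_ratio r s n Hs).
apply (Rle_div_r _ _ (1 - r / s)); [lra|].
pose proof (succ_mul_pow_le _ n Hq) as H1.
pose proof (pow_le _ (S n) (proj1 Hq)) as H2.
pose proof (pow_le _ n (Rlt_le _ _ Hs)) as H3.
pose proof (Cmod_ge_0 (a n)) as H4.
replace (INR (S n) * Cmod (a n) * (s ^ n * (r / s) ^ n) * (1 - r / s))
  with ((Cmod (a n) * s ^ n) * (INR (S n) * (r / s) ^ n * (1 - r / s))) by ring.
eapply Rle_trans; [|exact HM].
rewrite <- Rmult_1_r; apply Rmult_le_compat_l; [nra | lra].
Qed.

Definition deriv_coef (a : nat -> C) (n : nat) : C := (INR (S n) * a (S n))%C.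

Lemma tame_deriv_coef (a : nat -> C) : tame a -> tame (deriv_coef a).
Proof. intros Ha; apply (tame_mul_succ (fun n => a (S n))), tame_S, Ha. Qed.

(** If R_n is the first-order remainder of the power n + 1, then R_(n+1) = y R_n + (n + 1) z^n (y -
    z)^2. The factor r on the left avoids the exponent n - 1, and (n + 1)^2 is a convenient
    overestimate of n (n + 1) / 2. *)
Lemma pow_second_order (y z : C) (r : R) (n : nat) :
  0 < r -> Cmod y <= r -> Cmod z <= r ->
  Cmod (y ^ S n - z ^ S n - INR (S n) * z ^ n * (y - z)) * r
  <= INR (S n) ^ 2 * r ^ n * Cmod (y - z) ^ 2.
Proof.
intros Hr Hy Hz; induction n as [|n IH].
- replace (y ^ 1 - z ^ 1 - INR 1 * z ^ 0 * (y - z))%C with (RtoC 0)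
    by (simpl; ring).
  rewrite Cmod_0; simpl; pose proof (Cmod_ge_0 (y - z)); nra.
- replace (y ^ S (S n) - z ^ S (S n) - INR (S (S n)) * z ^ S n * (y - z))%C
    with (y * (y ^ S n - z ^ S n - INR (S n) * z ^ n * (y - z))
          + INR (S n) * z ^ n * (y - z) * (y - z))%C.
  2: { rewrite (S_INR (S n)), RtoC_plus, !Cpow_S; ring. }
  set (d := Cmod (y - z)) in *.
  assert (Hd : 0 <= d) by apply Cmod_ge_0.
  set (E := (y ^ S n - z ^ S n - INR (S n) * z ^ n * (y - z))%C) in *.
  assert (H1 : Cmod (y * E + INR (S n) * z ^ n * (y - z) * (y - z))
     <= r * Cmod E + INR (S n) * r ^ n * d ^ 2).
  { eapply Rle_trans; [apply Cmod_triangle|].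
    rewrite !Cmod_mult, Cmod_pow, Cmod_R, Rabs_pos_eq by apply pos_INR.
    fold d.
    assert (Cmod z ^ n <= r ^ n)
      by (apply pow_incr; split; [apply Cmod_ge_0 | exact Hz]).
    pose proof (Cmod_ge_0 E); pose proof (pos_INR (S n)).
    apply Rplus_le_compat; [apply Rmult_le_compat_r; assumption|].
    replace (d ^ 2) with (d * d) by ring; rewrite <- Rmult_assoc.
    repeat (apply Rmult_le_compat_r; [exact Hd|]).
    apply Rmult_le_compat_l; assumption. }
  eapply Rle_trans; [apply Rmult_le_compat_r, H1; lra|].
  rewrite (S_INR (S n)).
  assert (H2 : 0 <= r ^ S n * d ^ 2)
    by (apply Rmult_le_pos; apply pow_le; lra).
  pose proof (pos_INR (S n)) as H3.
  set (m := INR (S n)) in *.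
  apply (Rmult_le_compat_l r) in IH; [|lra].
  assert (H4 : 0 <= (m + 1) * (r ^ S n * d ^ 2)) by (apply Rmult_le_pos; lra).
  simpl in *; nra.
Qed.

(** Termwise differentiation: summing the second-order estimates of the powers bounds the remainder
    of [f] by B |y - z|^2 / r, where B is the sum of (n + 1)^2 |a_(n+1)| r^n for a radius r between
    |z| and 1. *)
Lemma has_pseries_derive (f g : C -> C) (a : nat -> C) (z : C) :
  has_pseries f a -> has_pseries g (deriv_coef a) -> in_disk z ->
  is_Cderive f z (g z).
Proof.
intros Hf Hg Hz; apply is_Cderive_eps; intros eps Heps.
pose proof (has_pseries_tame _ _ Hf) as Ha.
set (r := (1 + Cmod z) / 2).
assert (Hz' := Hz); unfold in_disk in Hz'; pose proof (Cmod_ge_0 z) as Hz0.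
assert (Hr : 0 < r < 1) by (unfold r; lra).
assert (Hzr : Cmod z < r) by (unfold r; lra).
destruct (tame_abs (fun n => (INR (S n) * deriv_coef a n)%C) r) as [B HB].
{ apply tame_mul_succ, tame_deriv_coef, Ha. }
{ lra. }
assert (HB0 : 0 <= B).
{ apply (is_lim_seq_le (fun _ => 0) (sum_n (fun n =>
    Cmod (INR (S n) * deriv_coef a n) * r ^ n)) 0 B);
    [|apply is_lim_seq_const|exact HB].
  intros n; rewrite <- (Rmult_0_r (INR (S n))), <- sum_n_const.
  apply sum_n_m_le; intros k.
  apply Rmult_le_pos; [apply Cmod_ge_0 | apply pow_le; lra]. }
(* The first bound keeps y within radius r, the second makes B |y - z| / r at most eps; B + 1 is
   positive even if B = 0. *)
set (d := Rmin (r - Cmod z) (eps * r / (B + 1))).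
assert (Hd : 0 < d).
{ apply Rmin_glb_lt; [unfold r; lra | apply Rdiv_lt_0_compat; nra]. }
exists d; split; [exact Hd|]; intros y Hy.
assert (Hy1 : Cmod (y - z) < r - Cmod z)
  by (eapply Rlt_le_trans; [exact Hy | apply Rmin_l]).
assert (Hy2 : Cmod (y - z) * (B + 1) < eps * r).
{ apply Rlt_div_r; [lra|]; eapply Rlt_le_trans; [exact Hy | apply Rmin_r]. }
pose proof (Cmod_minus_ge y z) as Hy3.
assert (Hyd : in_disk y) by (unfold in_disk; lra).
pose proof (proj1 (is_Cseries_S _ _) (Hf y Hyd)) as S1.
pose proof (is_Cseries_scal (RtoC (-1)) _ _
  (proj1 (is_Cseries_S _ _) (Hf z Hz))) as S2.
pose proof (is_Cseries_scal (- (y - z))%C _ _ (Hg z Hz)) as S3.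
pose proof (is_Cseries_plus _ _ _ _ (is_Cseries_plus _ _ _ _ S1 S2) S3) as S4.
pose proof (is_series_scal (K := R_AbsRing) (V := R_NormedModule)
  (Cmod (y - z) ^ 2 / r) _ _ HB) as S5.
replace (f y - f z - g z * (y - z))%C
  with (f y - a 0%nat * y ^ 0 + -1 * (f z - a 0%nat * z ^ 0)
     + - (y - z) * g z)%C by (simpl; ring).
eapply Rle_trans; [refine (Cmod_Cseries_le _ _ _ _ _ S4 S5); intros n|].
- change (Cmod (a (S n) * y ^ S n + -1 * (a (S n) * z ^ S n)
     + - (y - z) * (INR (S n) * a (S n) * z ^ n))
    <= Cmod (y - z) ^ 2 / r
       * (Cmod (INR (S n) * (INR (S n) * a (S n))) * r ^ n)).
  replace (a (S n) * y ^ S n + -1 * (a (S n) * z ^ S n)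
     + - (y - z) * (INR (S n) * a (S n) * z ^ n))%C
    with (a (S n) * (y ^ S n - z ^ S n - INR (S n) * z ^ n * (y - z)))%C
    by ring.
  rewrite !Cmod_mult, !Cmod_R, Rabs_pos_eq by apply pos_INR.
  pose proof (pow_second_order y z r n) as H.
  match goal with |- _ <= ?X =>
   replace X with (Cmod (a (S n)) * ((INR (S n) ^ 2 * r ^ n
      * Cmod (y - z) ^ 2) / r)) by (field; lra) end.
  apply Rmult_le_compat_l; [apply Cmod_ge_0|].
  apply (Rle_div_r _ _ r); [lra|]; apply H; lra.
- change (Cmod (y - z) ^ 2 / r * B <= eps * Cmod (y - z)).
  pose proof (Cmod_ge_0 (y - z)) as H0.
  replace (Cmod (y - z) ^ 2 / r * B) with (Cmod (y - z) * B / r * Cmod (y - z))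
    by (field; lra).
  apply Rmult_le_compat_r; [exact H0|]; apply (Rle_div_l _ _ r); [lra|]; nra.
Qed.

Lemma has_pseries_0 (f : C -> C) (a : nat -> C) :
  has_pseries f a -> f 0 = a 0%nat.
Proof.
intros H; pose proof (H 0 in_disk_0) as H0.
apply (is_Cseries_unique _ _ _ H0).
pose proof (is_Cseries_finite (fun n => (a n * 0 ^ n)%C) 0) as H1.
rewrite Csum_0 in H1; simpl in H1.
replace (a 0%nat * 1)%C with (a 0%nat) in H1 by ring; apply H1.
intros [|n] Hn; [lia|]; rewrite Cpow_S; ring.
Qed.

Lemma has_pseries_S (f g : C -> C) (a : nat -> C) (z : C) :
  has_pseries f a -> has_pseries g (fun n => a (S n)) -> in_disk z ->
  f z = (a 0%nat + z * g z)%C.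
Proof.
intros Hf Hg Hz.
pose proof (proj1 (is_Cseries_S _ _) (Hf z Hz)) as S1.
pose proof (is_Cseries_scal z _ _ (Hg z Hz)) as S2.
assert (E : (f z - a 0%nat * z ^ 0 = z * g z)%C).
{ apply (is_Cseries_unique _ _ _ S1).
  eapply is_Cseries_ext; [|exact S2]; intros n; simpl; ring. }
rewrite <- E; simpl; ring.
Qed.

Lemma has_pseries_derive_ex (f : C -> C) (a : nat -> C) :
  has_pseries f a -> exists g, has_pseries g (deriv_coef a) /\
    forall z, in_disk z -> is_Cderive f z (g z).
Proof.
intros Hf.
destruct (tame_pseries (deriv_coef a)) as [g Hg].
{ apply tame_deriv_coef, (has_pseries_tame f), Hf. }
exists g; split; [exact Hg|].
intros z Hz; apply (has_pseries_derive f g a); assumption.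
Qed.

Lemma has_pseries_S_ex (f : C -> C) (a : nat -> C) :
  has_pseries f a -> exists g, has_pseries g (fun n => a (S n)) /\
    forall z, in_disk z -> f z = (a 0%nat + z * g z)%C.
Proof.
intros Hf.
destruct (tame_pseries (fun n => a (S n))) as [g Hg].
{ apply tame_S, (has_pseries_tame f), Hf. }
exists g; split; [exact Hg|].
intros z Hz; apply has_pseries_S; assumption.
Qed.

(** * The equation [u' = p u] *)

(** Comparison of coefficients in u' = p u, u(0) = 1, where p has the coefficients [P] and the right
    side is a Cauchy product. *)
Definition ode_coef (P b : nat -> C) : Prop :=
  b 0%nat = RtoC 1 /\
  forall n, (INR (S n) * b (S n))%C = Csum (fun k => (b k * P (n - k)%nat)%C) n.

(* [ode_table P n] agrees with the solution of the recursion up to index [n]. *)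
Fixpoint ode_table (P : nat -> C) (n : nat) : nat -> C :=
  match n with
  | O => fun _ => RtoC 1
  | S m => fun k => if (k <=? m)%nat then ode_table P m k
      else (Csum (fun j => ode_table P m j * P (m - j)%nat) m / INR (S m))%C
  end.

Lemma ode_coef_ex (P : nat -> C) : exists b, ode_coef P b.
Proof.
exists (fun n => ode_table P n n).
assert (H : forall m k, (k <= m)%nat -> ode_table P m k = ode_table P k k).
{ induction m as [|m IH]; intros k Hk.
  - replace k with 0%nat by lia; reflexivity.
  - destruct (Nat.eq_dec k (S m)) as [->|Hne]; [reflexivity|].
    simpl; rewrite (proj2 (Nat.leb_le k m)) by lia; apply IH; lia. }
split; [reflexivity|]; intros n.
rewrite (Csum_ext _ (fun k => (ode_table P n k * P (n - k)%nat)%C)).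
2: { intros k Hk; rewrite (H n k Hk); reflexivity. }
replace (ode_table P (S n) (S n)) with
  (Csum (fun j => ode_table P n j * P (n - j)%nat) n / INR (S n))%C.
- field; intros E; apply RtoC_inj in E; apply (not_0_INR (S n)); auto.
- cbn [ode_table]; rewrite (proj2 (Nat.leb_gt (S n) n)) by lia; reflexivity.
Qed.

(** Passing from n to n + 1 multiplies S n t^n by at most (1 + M / (n + 1)) t, which is eventually
    at most 1; from then on the sequence does not increase. *)
Lemma subexponential_growth (S : nat -> R) (M t : R) :
  (forall n, 0 <= S n) -> 0 <= M -> 0 < t < 1 ->
  (forall n, S (n + 1)%nat <= S n * (1 + M / INR (n + 1))) ->
  exists K, forall n, S n * t ^ n <= K.
Proof.
intros HS HM Ht Hrec.
set (T := fun n => S n * t ^ n).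
assert (HT : forall n, 0 <= T n)
  by (intros n; apply Rmult_le_pos; [apply HS | apply pow_le; lra]).
destruct (INR_unbounded (M * t / (1 - t))) as [N HN].
assert (HN' : M * t < INR N * (1 - t)) by (apply Rlt_div_l in HN; lra).
assert (Hdec : forall n, (N <= n)%nat -> T (n + 1)%nat <= T n).
{ intros n Hn; unfold T.
  eapply Rle_trans; [apply Rmult_le_compat_r, Hrec; apply pow_le; lra|].
  assert (H1 : INR N <= INR n) by (apply le_INR; exact Hn).
  rewrite plus_INR, Nat.add_1_r; simpl (t ^ _); simpl (INR 1).
  pose proof (pos_INR N) as HN0.
  assert (H2 : (1 + M / (INR n + 1)) * t <= 1).
  { replace ((1 + M / (INR n + 1)) * t) with
      ((INR n * t + t + M * t) / (INR n + 1)) by (field; lra).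
    apply Rle_div_l; [lra|]; nra. }
  replace (S n * (1 + M / (INR n + 1)) * (t * t ^ n))
    with (T n * ((1 + M / (INR n + 1)) * t)) by (unfold T; ring).
  rewrite <- (Rmult_1_r (S n * t ^ n)); apply Rmult_le_compat_l;
    [apply HT|exact H2]. }
exists (sum_f_R0 T N); intros n; fold (T n).
assert (Hle : forall m k, (k <= m)%nat -> T k <= sum_f_R0 T m).
{ induction m as [|m IH]; intros k Hk; simpl.
  - replace k with 0%nat by lia; lra.
  - destruct (Nat.eq_dec k (Datatypes.S m)) as [->|Hne].
    + pose proof (IH 0%nat (Nat.le_0_l m)); pose proof (HT 0%nat); lra.
    + pose proof (IH k ltac:(lia)); pose proof (HT (Datatypes.S m)); lra. }
destruct (Nat.le_gt_cases n N) as [Hn|Hn]; [apply Hle, Hn|].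
apply Rle_trans with (T N); [|apply Hle; lia].
assert (Hn' : (N <= n)%nat) by lia; clear Hn.
induction Hn' as [|n Hn IH]; [lra|].
pose proof (Hdec n Hn) as H; rewrite Nat.add_1_r in H; lra.
Qed.

(** If |P_n| r^n is at most M, the recursion bounds (n + 1) |b_(n+1)| r^n by M T_n, with T_n the
    partial sum of |b_k| r^k. Hence T_(n+1) is at most T_n (1 + M / (n + 1)), a growth that the
    ratio r' / r < 1 outweighs. *)
Lemma ode_coef_tame (P b : nat -> C) : tame P -> ode_coef P b -> tame b.
Proof.
intros HP [Hb0 Hb] r' Hr'.
set (r := (1 + r') / 2).
assert (Hr : 0 < r < 1) by (unfold r; lra).
destruct (HP r Hr) as [M HM].
assert (HM0 : 0 <= M).
{ eapply Rle_trans; [|apply (HM 0%nat)]; simpl.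
  pose proof (Cmod_ge_0 (P 0%nat)); lra. }
set (T := sum_f_R0 (fun k => Cmod (b k) * r ^ k)).
assert (Hpos : forall k, 0 <= Cmod (b k) * r ^ k)
  by (intros k; apply Rmult_le_pos; [apply Cmod_ge_0 | apply pow_le; lra]).
assert (HT : forall n, 0 <= T n) by (intros n; apply cond_pos_sum, Hpos).
assert (Hconv : forall n m, (m <= n)%nat ->
  Cmod (Csum (fun k => b k * P (n - k)%nat)%C m) * r ^ n <= M * T m).
{ assert (Hterm : forall n k, (k <= n)%nat ->
    Cmod (b k * P (n - k)%nat) * r ^ n <= M * (Cmod (b k) * r ^ k)).
  { intros n k Hk; rewrite Cmod_mult.
    replace (r ^ n) with (r ^ k * r ^ (n - k))
      by (rewrite <- pow_add; f_equal; lia).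
    replace (Cmod (b k) * Cmod (P (n - k)%nat) * (r ^ k * r ^ (n - k))) with
      ((Cmod (P (n - k)%nat) * r ^ (n - k)) * (Cmod (b k) * r ^ k)) by ring.
    apply Rmult_le_compat_r; [apply Hpos | apply HM]. }
  intros n m; induction m as [|m IH]; intros Hm.
  - rewrite Csum_0; apply Hterm; lia.
  - rewrite Csum_S; unfold T; simpl sum_f_R0; fold (T m).
    rewrite Rmult_plus_distr_l.
    eapply Rle_trans;
      [apply Rmult_le_compat_r, Cmod_triangle; apply pow_le; lra|].
    rewrite Rmult_plus_distr_r; apply Rplus_le_compat;
      [apply IH; lia | apply Hterm; lia]. }
assert (Hrec : forall n, T (n + 1)%nat <= T n * (1 + M / INR (n + 1))).
{ intros n; rewrite Nat.add_1_r; unfold T at 1; simpl sum_f_R0; fold (T n).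
  assert (Hn : 0 < INR (S n)) by (apply lt_0_INR; lia).
  cut (Cmod (b (S n)) * (r * r ^ n) <= M * T n / INR (S n)).
  { intros H; unfold Rdiv in *; lra. }
  apply (Rle_div_r _ _ (INR (S n))); [exact Hn|].
  specialize (Hconv n n (Nat.le_refl n)); rewrite <- Hb in Hconv.
  rewrite Cmod_mult, Cmod_R, Rabs_pos_eq in Hconv by lra.
  eapply Rle_trans; [|exact Hconv].
  replace (Cmod (b (S n)) * (r * r ^ n) * INR (S n))
    with (r * (INR (S n) * Cmod (b (S n)) * r ^ n)) by ring.
  rewrite <- (Rmult_1_l (INR (S n) * Cmod (b (S n)) * r ^ n)) at 2.
  apply Rmult_le_compat_r; [|lra].
  apply Rmult_le_pos; [|apply pow_le; lra].
  apply Rmult_le_pos; [lra | apply Cmod_ge_0]. }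
destruct (subexponential_growth T M (r' / r) HT HM0) as [K HK];
  [split; [apply Rdiv_lt_0_compat; lra | apply Rlt_div_l; unfold r; lra]
  | exact Hrec |].
exists K; intros n.
eapply Rle_trans; [|apply (HK n)].
rewrite (pow_ratio r' r n) by lra; rewrite <- Rmult_assoc.
apply Rmult_le_compat_r.
{ apply pow_le, Rlt_le, Rdiv_lt_0_compat; lra. }
unfold T; destruct n as [|n]; [simpl; lra|].
simpl sum_f_R0; pose proof (HT n) as H; unfold T in H; simpl in *; lra.
Qed.

Lemma ode_coef_solution (p g : C -> C) (P b : nat -> C) :
  has_pseries p P -> ode_coef P b -> has_pseries g b ->
  forall z, in_disk z -> is_Cderive g z (p z * g z).
Proof.
intros Hp Hb Hg z Hz.
pose proof (has_pseries_tame _ _ Hp) as HP.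
pose proof (ode_coef_tame P b HP Hb) as Hb'.
destruct (has_pseries_derive_ex g b Hg) as [g' [Hg' Hd]].
eapply is_Cderive_eq; [apply Hd, Hz|].
apply (is_Cseries_unique _ _ _ (Hg' z Hz)).
rewrite Cmult_comm.
eapply is_Cseries_ext;
  [|apply (is_Cseries_mult _ _ _ _ (Hg z Hz) (Hp z Hz));
    apply tame_abs_disk; assumption].
intros n; simpl; unfold deriv_coef; rewrite (proj2 Hb n).
rewrite (Cmult_comm _ (z ^ n)), <- Csum_mult_l.
apply Csum_ext; intros k Hk.
replace (z ^ n)%C with (z ^ k * z ^ (n - k))%C
  by (rewrite <- Cpow_add_r; f_equal; lia).
ring.
Qed.

(* The solution of [v' = - p v] with [v 0 = 1] serves as an integrating factor:
   its product with any solution of [u' = p u] is constant. *)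
Lemma linear_ode (p : C -> C) (P : nat -> C) : has_pseries p P ->
  exists g b, ode_coef P b /\ has_pseries g b /\
    (forall z, in_disk z -> is_Cderive g z (p z * g z)) /\
    (forall z, in_disk z -> g z <> 0) /\
    (forall u : C -> C, u 0 = RtoC 1 ->
      (forall z, in_disk z -> is_Cderive u z (p z * u z)) ->
      forall z, in_disk z -> u z = g z).
Proof.
intros Hp.
destruct (ode_coef_ex P) as [b Hb].
destruct (tame_pseries b) as [g Hg].
{ apply (ode_coef_tame P); [apply (has_pseries_tame p), Hp | exact Hb]. }
assert (Hq : has_pseries (fun z => (-1 * p z)%C) (fun n => (-1 * P n)%C)).
{ intros z Hz; eapply is_Cseries_ext;
    [|apply (is_Cseries_scal (RtoC (-1)) _ _ (Hp z Hz))].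
  intros n; simpl; ring. }
destruct (ode_coef_ex (fun n => (-1 * P n)%C)) as [c Hc].
destruct (tame_pseries c) as [v Hv].
{ eapply ode_coef_tame; [apply (has_pseries_tame _ _ Hq) | exact Hc]. }
pose proof (ode_coef_solution _ _ _ _ Hp Hb Hg) as Dg.
pose proof (ode_coef_solution _ _ _ _ Hq Hc Hv) as Dv.
assert (Hg0 : g 0 = RtoC 1) by (rewrite (has_pseries_0 _ _ Hg); apply Hb).
assert (Hv0 : v 0 = RtoC 1) by (rewrite (has_pseries_0 _ _ Hv); apply Hc).
assert (K : forall u : C -> C, u 0 = RtoC 1 ->
  (forall z, in_disk z -> is_Cderive u z (p z * u z)) ->
  forall z, in_disk z -> (u z * v z)%C = RtoC 1).
{ intros u Hu0 Du z Hz.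
  rewrite (Cderive_0_const (fun y => (u y * v y)%C)); [|clear z Hz|exact Hz].
  - rewrite Hu0, Hv0; ring.
  - intros z Hz; eapply is_Cderive_eq;
      [apply is_Cderive_mult; [apply Du | apply Dv]; exact Hz | simpl; ring]. }
exists g, b; split; [exact Hb|]; split; [exact Hg|]; split; [exact Dg|].
split.
- intros z Hz E; specialize (K g Hg0 Dg z Hz); rewrite E in K.
  assert (E1 : RtoC 1 = RtoC 0) by (rewrite <- K; ring).
  apply RtoC_inj in E1; lra.
- intros u Hu0 Du z Hz.
  pose proof (K u Hu0 Du z Hz) as K1; pose proof (K g Hg0 Dg z Hz) as K2.
  replace (u z) with (u z * (g z * v z))%C by (rewrite K2; ring).
  replace (u z * (g z * v z))%C with (u z * v z * g z)%C by ring.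
  rewrite K1; ring.
Qed.

(** * The function [psi_AP] *)

Lemma Cexp_plus (z w : C) : Cexp (z + w) = (Cexp z * Cexp w)%C.
Proof.
destruct z as [a b], w as [c d]; unfold Cexp, Cplus, Cmult, Re, Im; simpl.
rewrite exp_plus, cos_plus, sin_plus; f_equal; ring.
Qed.

Lemma Cexp_0 : Cexp 0 = RtoC 1.
Proof.
unfold Cexp, RtoC, Re, Im; simpl; rewrite exp_0, cos_0, sin_0; f_equal; ring.
Qed.

(** The remainder is written through the first-order remainders of the real exp, sin and cos, each
    with a bounded factor, and the product x y. *)
Lemma is_Cderive_Cexp_0 : is_Cderive Cexp 0 1.
Proof.
apply is_Cderive_eps; intros eps Heps.
(* The five error terms contribute 1, 2, 3, 1 and 1 times e |z|. *)
set (e := Rmin 1 (eps / 8)).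
assert (He : 0 < e) by (apply Rmin_glb_lt; lra).
assert (He1 : e <= 1) by apply Rmin_l.
assert (He2 : e <= eps / 8) by apply Rmin_r.
assert (D : forall f l, derivable_pt_lim f 0 l -> exists d, 0 < d /\
  forall h, Rabs h < d -> Rabs (f h - f 0 - l * h) <= e * Rabs h).
{ intros f l Hf; destruct (Hf e He) as [d Hd]; exists d; split;
    [apply cond_pos|]; intros h Hh.
  destruct (Req_dec h 0) as [->|Hh0].
  { replace (f 0 - f 0 - l * 0) with 0 by ring; rewrite Rabs_R0; lra. }
  specialize (Hd h Hh0 Hh); rewrite Rplus_0_l in Hd.
  replace (f h - f 0 - l * h) with (((f h - f 0) / h - l) * h)
    by (field; exact Hh0).
  rewrite Rabs_mult; apply Rmult_le_compat_r; [apply Rabs_pos | lra]. }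
destruct (D exp 1 derivable_pt_lim_exp_0) as [d1 [Hd1 E1]].
destruct (D sin 1 derivable_pt_lim_sin_0) as [d2 [Hd2 E2]].
destruct (D cos (- sin 0) (derivable_pt_lim_cos 0)) as [d3 [Hd3 E3]].
rewrite exp_0 in E1; rewrite sin_0 in E2, E3; rewrite cos_0 in E3.
set (d := Rmin (Rmin d1 d2) (Rmin d3 e)).
exists d; split.
{ apply Rmin_glb_lt; apply Rmin_glb_lt; assumption. }
intros [x y] Hxy.
replace ((x, y) - 0)%C with (x, y) in *
  by (unfold Cminus, Cplus, Copp, RtoC; simpl; f_equal; ring).
pose proof (re_le_Cmod (x, y)) as Hx; pose proof (Im_le_Cmod (x, y)) as Hy.
unfold Re, Im in Hx, Hy; simpl in Hx, Hy.
set (m := Cmod (x, y)) in *.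
assert (m < d1 /\ m < d2 /\ m < d3 /\ m < e) as (M1 & M2 & M3 & M4).
{ unfold d in Hxy.
  pose proof (Rmin_l (Rmin d1 d2) (Rmin d3 e)).
  pose proof (Rmin_r (Rmin d1 d2) (Rmin d3 e)).
  pose proof (Rmin_l d1 d2); pose proof (Rmin_r d1 d2).
  pose proof (Rmin_l d3 e); pose proof (Rmin_r d3 e); lra. }
specialize (E1 x ltac:(lra)); specialize (E2 y ltac:(lra));
  specialize (E3 y ltac:(lra)).
rewrite Cexp_0.
replace (Cexp (x, y) - 1 - 1 * (x, y))%C with
  (((exp x - 1 - 1 * x) * cos y + (1 + x) * (cos y - 1 - - 0 * y))%R,
   (exp x * (sin y - 0 - 1 * y) + (exp x - 1 - 1 * x) * y + x * y)%R).
2: { unfold Cexp, Cminus, Cplus, Cmult, Copp, RtoC, Re, Im; simpl.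
     f_equal; ring. }
eapply Rle_trans; [apply Cmod_le_sum|].
assert (Hm : 0 <= m) by apply Cmod_ge_0.
assert (Hex : Rabs (exp x) <= 3).
{ replace (exp x) with ((exp x - 1 - 1 * x) + x + 1) by ring.
  eapply Rle_trans; [apply Rabs_triang|].
  eapply Rle_trans; [apply Rplus_le_compat_r, Rabs_triang|].
  rewrite (Rabs_pos_eq 1) by lra; nra. }
assert (Hcos : Rabs (cos y) <= 1)
  by (apply Rabs_le; pose proof (COS_bound y); lra).
assert (H1x : Rabs (1 + x) <= 2).
{ eapply Rle_trans; [apply Rabs_triang|]; rewrite (Rabs_pos_eq 1); lra. }
pose proof (Rabs_pos x) as X0; pose proof (Rabs_pos y) as Y0.
assert (B : forall u v A B : R, Rabs u <= A -> Rabs v <= B ->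
  Rabs (u * v) <= A * B).
{ intros u v A B' HA HB; rewrite Rabs_mult; apply Rmult_le_compat;
    try apply Rabs_pos; assumption. }
assert (Q1 : Rabs (exp x - 1 - 1 * x) <= e * m) by nra.
assert (Q2 : Rabs (sin y - 0 - 1 * y) <= e * m) by nra.
assert (Q3 : Rabs (cos y - 1 - - 0 * y) <= e * m) by nra.
assert (Hy' : Rabs y <= 1) by lra.
pose proof (B _ _ _ _ Q1 Hcos) as T1.
pose proof (B _ _ _ _ H1x Q3) as T2.
pose proof (B _ _ _ _ Hex Q2) as T3.
pose proof (B _ _ _ _ Q1 Hy') as T4.
assert (T5 : Rabs (x * y) <= e * m) by (apply B; lra).
eapply Rle_trans; [apply Rplus_le_compat; [apply Rabs_triang|]|].
{ eapply Rle_trans; [apply Rabs_triang|].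
  apply Rplus_le_compat_r, Rabs_triang. }
assert (e * m <= eps / 8 * m) by (apply Rmult_le_compat_r; assumption).
lra.
Qed.

(** The functional equation carries the derivative at 0 to every point. *)
Lemma is_Cderive_Cexp (z : C) : is_Cderive Cexp z (Cexp z).
Proof.
assert (H : is_Cderive (fun y => Cexp z * Cexp (y + - z))%C z (Cexp z)).
{ eapply is_Cderive_eq; [apply is_Cderive_mult; [apply is_Cderive_const|]|].
  - apply (is_Cderive_comp (fun y => y + - z)%C Cexp).
    + apply is_Cderive_plus; [apply is_Cderive_id | apply is_Cderive_const].
    + replace (z + - z)%C with (RtoC 0) by ring; apply is_Cderive_Cexp_0.
  - simpl; ring. }
apply (is_Cderive_ext_loc _ _ z _ 1 Rlt_0_1) with (2 := H).
intros y _; rewrite <- Cexp_plus; f_equal; ring.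
Qed.

Lemma Re_Csqrt_pos (z : C) : 0 < Re z -> 0 < Re (Csqrt z).
Proof.
intros H; unfold Csqrt, Re at 1; simpl; apply sqrt_lt_R0.
pose proof (Cmod_ge_0 z); lra.
Qed.

(** For s and t the roots of z and y, the remainder is -(t - s)^2 / (2 s). Since Re t is
    nonnegative, |t + s| is at least Re s > 0, so y - z = (t - s) (t + s) controls t - s. *)
Lemma is_Cderive_Csqrt (z : C) :
  0 < Re z -> is_Cderive Csqrt z (/ (2 * Csqrt z)).
Proof.
intros Hz; apply is_Cderive_eps; intros eps Heps.
set (s := Csqrt z); set (r := Re s).
assert (Hr : 0 < r) by (apply Re_Csqrt_pos, Hz).
assert (Hrs : r <= Cmod s)
  by (eapply Rle_trans; [apply Rle_abs | apply re_le_Cmod]).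
assert (Hs0 : s <> 0) by (apply Cmod_neq_0; lra).
assert (H2s : Cmod (2 * s) = 2 * Cmod s)
  by (rewrite Cmod_mult, Cmod_R, Rabs_pos_eq; lra).
(* Dividing |t - s| |t + s| by r leaves |t - s| at most 2 eps r^2, hence at most eps |t + s| |2
   s|. *)
exists (eps * (r * r * (2 * r))); split.
{ apply Rmult_lt_0_compat; [lra|]; repeat apply Rmult_lt_0_compat; lra. }
intros y Hy; set (t := Csqrt y).
assert (Es : (s * s)%C = z) by apply Csqrt_sqr.
assert (Et : (t * t)%C = y) by apply Csqrt_sqr.
assert (Hst : r <= Cmod (t + s)).
{ eapply Rle_trans; [|apply re_le_Cmod]; eapply Rle_trans; [|apply Rle_abs].
  rewrite re_plus; pose proof (Csqrt_Re_ge0 y); unfold r, t; lra. }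
replace (t - s - / (2 * s) * (y - z))%C
  with (- ((t - s) * (t - s)) / (2 * s))%C
  by (rewrite <- Es, <- Et; field; exact Hs0).
assert (H2s0 : (2 * s)%C <> 0) by (apply Cmod_neq_0; lra).
rewrite Cmod_div, Cmod_opp, Cmod_mult, H2s by exact H2s0.
rewrite <- Es, <- Et in *.
replace (t * t - s * s)%C with ((t - s) * (t + s))%C in * by ring.
rewrite Cmod_mult in *.
set (u := Cmod (t - s)) in *; set (v := Cmod (t + s)) in *.
assert (Hu : 0 <= u) by apply Cmod_ge_0.
apply Rle_div_l; [lra|].
assert (Hu' : u * r < eps * (r * r * (2 * r))) by nra.
assert (Hu2 : u <= eps * (2 * r * r)).
{ apply Rmult_le_reg_r with r; [lra|].
  replace (eps * (2 * r * r) * r) with (eps * (r * r * (2 * r))) by ring; lra. }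
assert (H3 : 2 * r * r <= v * (2 * Cmod s)) by nra.
assert (H4 : u <= eps * (v * (2 * Cmod s))).
{ eapply Rle_trans; [exact Hu2|]; apply Rmult_le_compat_l; lra. }
replace (eps * (u * v) * (2 * Cmod s)) with (u * (eps * (v * (2 * Cmod s))))
  by ring.
apply Rmult_le_compat_l; assumption.
Qed.

Definition psi_log_deriv (z : C) : C := (1 + / 2 * / (1 + z))%C.

Lemma Re_1_plus_pos (z : C) : in_disk z -> 0 < Re (1 + z).
Proof.
unfold in_disk; intros H; rewrite re_plus, re_RtoC.
pose proof (re_le_Cmod z) as H1; apply Rabs_le_between in H1; lra.
Qed.

Lemma one_plus_neq_0 (z : C) : in_disk z -> (1 + z)%C <> 0.
Proof.
intros Hz E; pose proof (Re_1_plus_pos z Hz) as H; rewrite E, re_RtoC in H; lra.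
Qed.

Lemma two_neq_0 : RtoC 2 <> 0.
Proof. intros E; apply RtoC_inj in E; lra. Qed.

Lemma is_Cderive_psi_AP (z : C) :
  in_disk z -> is_Cderive psi_AP z (psi_log_deriv z * psi_AP z).
Proof.
intros Hz; pose proof (Re_1_plus_pos z Hz) as H.
eapply is_Cderive_eq.
- apply is_Cderive_mult; [apply is_Cderive_Cexp|].
  apply (is_Cderive_comp (fun y => 1 + y)%C Csqrt).
  + apply is_Cderive_plus; [apply is_Cderive_const | apply is_Cderive_id].
  + apply is_Cderive_Csqrt; exact H.
- unfold psi_log_deriv, psi_AP.
  pose proof (one_plus_neq_0 z Hz) as H1.
  rewrite <- (Csqrt_sqr (1 + z)) at 3.
  assert (Hs : Csqrt (1 + z) <> 0).
  { intros E; apply H1; rewrite <- (Csqrt_sqr (1 + z)), E; ring. }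
  field; exact Hs.
Qed.

Lemma psi_AP_0 : psi_AP 0 = RtoC 1.
Proof.
unfold psi_AP; rewrite Cexp_0, Cplus_0_r, Cmult_1_l; unfold Csqrt.
rewrite Cmod_1, re_RtoC, im_RtoC.
destruct (Rle_dec 0 0) as [_|n]; [|lra].
replace ((1 + 1) / 2) with 1 by field; replace ((1 - 1) / 2) with 0 by field.
rewrite sqrt_1, sqrt_0; unfold RtoC; f_equal; ring.
Qed.

(** * Explicit power series and the first coefficients of psi(z) and psi(z^2) *)

Lemma has_pseries_monomial (c : C) (N : nat) :
  has_pseries (fun z => c * z ^ N)%C (fun n => if n =? N then c else RtoC 0).
Proof.
intros z _.
pose proof (is_Cseries_finite
  (fun n => ((if n =? N then c else RtoC 0) * z ^ n)%C) N) as H.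
replace (c * z ^ N)%C
  with (Csum (fun n => ((if n =? N then c else RtoC 0) * z ^ n)%C) N).
- apply H; intros n Hn; rewrite (proj2 (Nat.eqb_neq n N)) by lia; ring.
- assert (H0 : forall m, (m < N)%nat ->
    Csum (fun n => ((if n =? N then c else RtoC 0) * z ^ n)%C) m = 0).
  { induction m as [|m IH]; intros Hm.
    - rewrite Csum_0, (proj2 (Nat.eqb_neq 0 N)) by lia; ring.
    - rewrite Csum_S, IH, (proj2 (Nat.eqb_neq (S m) N)) by lia; ring. }
  destruct N as [|N]; [rewrite Csum_0; reflexivity|].
  rewrite Csum_S, H0, Nat.eqb_refl by lia; ring.
Qed.

Lemma has_pseries_geom (q : C) : Cmod q = 1 ->
  has_pseries (fun z => / (1 - q * z))%C (fun n => (q ^ n)%C).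
Proof.
intros Hq z Hz.
eapply is_Cseries_ext; [|apply is_Cseries_geom].
- intros n; simpl; rewrite Cpow_mult_l; reflexivity.
- rewrite Cmod_mult, Hq, Rmult_1_l; exact Hz.
Qed.

Lemma has_pseries_plus (f g : C -> C) (a b : nat -> C) :
  has_pseries f a -> has_pseries g b ->
  has_pseries (fun z => f z + g z)%C (fun n => a n + b n)%C.
Proof.
intros Hf Hg z Hz.
eapply is_Cseries_ext;
  [|apply is_Cseries_plus; [apply Hf | apply Hg]; exact Hz].
intros n; simpl; ring.
Qed.

Lemma has_pseries_scal (c : C) (f : C -> C) (a : nat -> C) :
  has_pseries f a -> has_pseries (fun z => c * f z)%C (fun n => c * a n)%C.
Proof.
intros Hf z Hz.
eapply is_Cseries_ext; [|apply is_Cseries_scal, Hf, Hz].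
intros n; simpl; ring.
Qed.

Lemma has_pseries_ext (f g : C -> C) (a : nat -> C) :
  (forall z, in_disk z -> f z = g z) -> has_pseries f a -> has_pseries g a.
Proof. intros H Hf z Hz; rewrite <- H by exact Hz; apply Hf, Hz. Qed.

Lemma ode_coef_1 (P b : nat -> C) : ode_coef P b -> b 1%nat = P 0%nat.
Proof.
intros [H0 H]; specialize (H 0%nat); rewrite Csum_0, H0 in H; simpl in H.
replace (b 1%nat) with (1 * b 1%nat)%C by ring; rewrite H; ring.
Qed.

Lemma ode_coef_2 (P b : nat -> C) :
  ode_coef P b -> b 2%nat = ((P 0%nat * P 0%nat + P 1%nat) / 2)%C.
Proof.
intros HP; pose proof (ode_coef_1 P b HP) as H1; destruct HP as [H0 H].
specialize (H 1%nat); rewrite Csum_S, Csum_0, H0, H1 in H; simpl in H.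
replace (b 2%nat) with ((1 + 1) * b 2%nat / 2)%C.
- rewrite <- RtoC_plus, H; field.
- field.
Qed.

Lemma psi_log_deriv_pseries :
  has_pseries psi_log_deriv
    (fun n => (if n =? 0 then 1 else 0) + / 2 * (-1) ^ n)%C.
Proof.
eapply has_pseries_ext; [|apply has_pseries_plus;
  [apply has_pseries_monomial | apply has_pseries_scal, has_pseries_geom]].
- intros z Hz; unfold psi_log_deriv; simpl.
  replace (1 - -1 * z)%C with (1 + z)%C by ring; ring.
- rewrite Cmod_R, Rabs_left; lra.
Qed.

Lemma is_Cderive_psi_AP_sqr (z : C) : in_disk z ->
  is_Cderive (fun y => psi_AP (y * y)) z
    (2 * z * psi_log_deriv (z * z) * psi_AP (z * z)).
Proof.
intros Hz; eapply is_Cderive_eq.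
- apply (is_Cderive_comp (fun y => y * y)%C psi_AP).
  + apply is_Cderive_mult; apply is_Cderive_id.
  + apply is_Cderive_psi_AP; unfold in_disk in *; rewrite Cmod_mult.
    pose proof (Cmod_ge_0 z); nra.
- simpl; ring.
Qed.

(* [2 z (1 + 1 / (2 (1 + z^2))) = 2 z - (i/2) (1 / (1 - i z) - 1 / (1 + i z))]. *)
Lemma psi_sqr_log_deriv_pseries :
  has_pseries (fun z => 2 * z * psi_log_deriv (z * z))%C
    (fun n => (if n =? 1 then 2 else 0)
       + (- Ci / 2 * Ci ^ n + Ci / 2 * (- Ci) ^ n))%C.
Proof.
eapply has_pseries_ext; [|apply has_pseries_plus;
  [apply has_pseries_monomial
  | apply has_pseries_plus; apply has_pseries_scal, has_pseries_geom]].
- intros z Hz; unfold psi_log_deriv; simpl.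
  assert (Hz2 : in_disk (z * z)).
  { unfold in_disk in *; rewrite Cmod_mult; pose proof (Cmod_ge_0 z); nra. }
  pose proof (one_plus_neq_0 _ Hz2) as H.
  assert (HI : (Ci * Ci)%C = RtoC (-1))
    by (unfold Ci, Cmult, RtoC; simpl; f_equal; ring).
  assert (E : ((1 - Ci * z) * (1 - - Ci * z))%C = (1 + z * z)%C).
  { replace ((1 - Ci * z) * (1 - - Ci * z))%C with (1 - (Ci * Ci) * z * z)%C
      by ring.
    rewrite HI; ring. }
  assert (H1 : (1 - Ci * z)%C <> 0)
    by (intros K; apply H; rewrite <- E, K; ring).
  assert (H2 : (1 - - Ci * z)%C <> 0)
    by (intros K; apply H; rewrite <- E, K; ring).
  rewrite <- E.
  replace (- Ci / 2 * / (1 - Ci * z) + Ci / 2 * / (1 - - Ci * z))%C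
    with (- (Ci * Ci) * z * / ((1 - Ci * z) * (1 - - Ci * z)))%C
    by (field; repeat split; auto using two_neq_0).
  rewrite HI; field; repeat split; auto using two_neq_0.
- apply Cmod_Ci.
- rewrite Cmod_opp; apply Cmod_Ci.
Qed.

(** Uniqueness identifies the given [u] with the constructed solution, which transfers both the
    power series and the absence of zeros. *)
Lemma ode_solution_pseries (p u : C -> C) (P : nat -> C) :
  has_pseries p P -> u 0 = RtoC 1 ->
  (forall z, in_disk z -> is_Cderive u z (p z * u z)) ->
  exists b, ode_coef P b /\ has_pseries u b /\
    forall z, in_disk z -> u z <> 0.
Proof.
intros Hp Hu0 Hu.
destruct (linear_ode p P Hp) as (g & b & Hb & Hg & _ & Hnz & Huniq).
exists b; split; [exact Hb|]; split.
- apply (has_pseries_ext g); [|exact Hg].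
  intros z Hz; symmetry; apply Huniq; assumption.
- intros z Hz; rewrite Huniq by assumption; apply Hnz, Hz.
Qed.

(** The logarithmic derivative begins 3/2 - z/2, so the recursion gives 3/2 and then (9/4 - 1/2) / 2
    = 7/8. *)
Lemma psi_AP_pseries : exists b, has_pseries psi_AP b /\
  b 0%nat = RtoC 1 /\ b 1%nat = RtoC (3 / 2) /\ b 2%nat = RtoC (7 / 8) /\
  forall z, in_disk z -> psi_AP z <> 0.
Proof.
destruct (ode_solution_pseries _ psi_AP _ psi_log_deriv_pseries psi_AP_0
  is_Cderive_psi_AP) as (b & Hb & Hs & Hnz).
exists b; split; [exact Hs|]; split; [apply Hb|].
rewrite (ode_coef_2 _ _ Hb), (ode_coef_1 _ _ Hb); simpl.
split; [rewrite RtoC_div by lra; field|].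
split; [rewrite RtoC_div by lra; field | exact Hnz].
Qed.

(** psi(z^2) solves a linear equation of its own, which avoids substituting into a power series. Its
    logarithmic derivative begins with 3 z, whence the coefficient 3/2. *)
Lemma psi_AP_sqr_pseries : exists b, has_pseries (fun z => psi_AP (z * z)) b /\
  b 0%nat = RtoC 1 /\ b 1%nat = RtoC 0 /\ b 2%nat = RtoC (3 / 2).
Proof.
destruct (ode_solution_pseries _ (fun z => psi_AP (z * z)) _
  psi_sqr_log_deriv_pseries) as (b & Hb & Hs & _).
- replace (0 * 0)%C with (RtoC 0) by ring; apply psi_AP_0.
- apply is_Cderive_psi_AP_sqr.
- exists b; split; [exact Hs|]; split; [apply Hb|].
  rewrite (ode_coef_2 _ _ Hb), (ode_coef_1 _ _ Hb); simpl.
  split; [field|].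
  replace ((0 + (- Ci / 2 * 1 + Ci / 2 * 1)) * (0 + (- Ci / 2 * 1 + Ci / 2 * 1))
    + (2 + (- Ci / 2 * (Ci * 1) + Ci / 2 * (- Ci * 1))))%C
    with (2 - Ci * Ci)%C by field.
  replace (Ci * Ci)%C with (RtoC (-1))
    by (unfold Ci, Cmult, RtoC; simpl; f_equal; ring).
  rewrite RtoC_div by lra; field.
Qed.

(** * Mean values over circles *)

(** Translates complex continuity into the joint real continuity required for differentiation under
    the integral. *)
Lemma continuity_2d_pt_Ccomp (H : C -> C) (A B : R -> R -> R) (s t : R) :
  Ccontinuous H (A s t, B s t) ->
  continuity_2d_pt A s t -> continuity_2d_pt B s t ->
  continuity_2d_pt (fun u v => Re (H (A u v, B u v))) s t /\
  continuity_2d_pt (fun u v => Im (H (A u v, B u v))) s t.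
Proof.
intros HH HA HB; rewrite Ccontinuous_eps in HH.
assert (K : forall eps : posreal, locally_2d (fun u v =>
  Cmod (H (A u v, B u v) - H (A s t, B s t)) < eps) s t).
{ intros eps; destruct (HH eps (cond_pos eps)) as [d [Hd1 Hd2]].
  assert (Hd : 0 < d / 2) by lra.
  generalize (locally_2d_and _ _ _ _ (HA (mkposreal _ Hd))
    (HB (mkposreal _ Hd))).
  apply locally_2d_impl, locally_2d_forall; intros u v [H1 H2]; simpl in H1, H2.
  apply Hd2.
  replace ((A u v, B u v) - (A s t, B s t))%C
    with ((A u v - A s t)%R, (B u v - B s t)%R)
    by (unfold Cminus, Cplus, Copp; simpl; f_equal; ring).
  eapply Rle_lt_trans; [apply Cmod_le_sum | lra]. }
split; intros eps; generalize (K eps); apply locally_2d_impl, locally_2d_forall;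
  intros u v Huv; (eapply Rle_lt_trans; [|exact Huv]).
- exact (re_le_Cmod (H (A u v, B u v) - H (A s t, B s t))).
- exact (Im_le_Cmod (H (A u v, B u v) - H (A s t, B s t))).
Qed.

Lemma continuity_2d_pt_slice (f : R -> R -> R) (s t : R) :
  continuity_2d_pt f s t -> continuous (f s) t.
Proof.
intros H; apply continuity_pt_filterlim; intros eps Heps.
destruct (H (mkposreal eps Heps)) as [d Hd].
exists d; split; [apply cond_pos|]; intros y [_ Hy]; apply Hd; [|exact Hy].
replace (s - s) with 0 by ring; rewrite Rabs_R0; apply cond_pos.
Qed.

Lemma Cmod_polar (s t : R) : 0 <= s -> Cmod (s * cos t, s * sin t) = s.
Proof.
intros Hs; unfold Cmod; simpl.
replace (s * cos t * (s * cos t * 1) + s * sin t * (s * sin t * 1))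
  with (Rsqr s).
- apply sqrt_Rsqr, Hs.
- pose proof (sin2_cos2 t) as H; unfold Rsqr in *.
  replace (s * s) with (s * s * (sin t * sin t + cos t * cos t))
    by (rewrite H; ring).
  ring.
Qed.

(* The Cauchy-Riemann equation
   [d/dt Im G (s e^{it}) = s d/ds Re G (s e^{it})] shows that the mean of [Re G]
   over the circle of radius [s] does not depend on [s]. *)
Lemma Re_limit_le_circle (G G' : C -> C) (L : C) (M r : R) : 0 < r < 1 ->
  (forall z, in_disk z -> z <> 0 -> is_Cderive G z (G' z)) ->
  (forall z, in_disk z -> z <> 0 -> Ccontinuous G' z) ->
  (forall eps, 0 < eps -> exists del, 0 < del /\
     forall z : C, z <> 0 -> Cmod z < del -> Cmod (G z - L) < eps) ->
  (forall z, Cmod z = r -> Re (G z) <= M) ->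
  Re L <= M.
Proof.
intros Hr HD HC HL HM.
assert (Hpt : forall s t, 0 < s < 1 ->
  in_disk (s * cos t, s * sin t) /\ (s * cos t, s * sin t) <> RtoC 0).
{ intros s t Hs; unfold in_disk.
  assert (E : Cmod (s * cos t, s * sin t) = s) by (apply Cmod_polar; lra).
  split; [rewrite E; lra | apply Cmod_neq_0; rewrite E; lra]. }
set (U := fun s t => Re (G (s * cos t, s * sin t))).
(* [W] is the radial derivative of Re G, and s W turns out to be the angular derivative of Im G. *)
set (W := fun s t => Re (G' (s * cos t, s * sin t) * (cos t, sin t))).
assert (DU : forall s t, 0 < s < 1 -> is_derive (fun u => U u t) s (W s t)).
{ intros s t Hs; destruct (Hpt s t Hs) as [P1 P2].
  apply (is_derive_curve G (fun u => u * cos t) (fun u => u * sin t));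
    [apply HD; assumption | auto_derive; [trivial | ring]..]. }
assert (DT : forall s t, 0 < s < 1 ->
  ex_derive (U s) t /\
  is_derive (fun v => Im (G (s * cos v, s * sin v))) t (s * W s t)).
{ intros s t Hs; destruct (Hpt s t Hs) as [P1 P2].
  destruct (is_derive_curve G (fun v => s * cos v) (fun v => s * sin v) t
    (- s * sin t) (s * cos t) _ (HD _ P1 P2)) as [D1 D2];
    [auto_derive; [trivial | ring]..|].
  split; [eexists; exact D1|].
  replace (s * W s t) with
    (Im (G' (s * cos t, s * sin t) * ((- s * sin t)%R, (s * cos t)%R)));
    [exact D2|].
  unfold W; rewrite im_mult, re_mult; unfold Re, Im; simpl; ring. }
assert (Ccos : forall s t, continuity_2d_pt (fun _ v => cos v) s t).
{ intros s t; apply (continuity_1d_2d_pt_comp cos (fun _ v => v));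
    [apply continuity_cos | apply continuity_2d_pt_id2]. }
assert (Csin : forall s t, continuity_2d_pt (fun _ v => sin v) s t).
{ intros s t; apply (continuity_1d_2d_pt_comp sin (fun _ v => v));
    [apply continuity_sin | apply continuity_2d_pt_id2]. }
assert (CW : forall s t, 0 < s < 1 -> continuity_2d_pt W s t).
{ intros s t Hs; destruct (Hpt s t Hs) as [P1 P2].
  destruct (continuity_2d_pt_Ccomp G' (fun u v => u * cos v)
    (fun u v => u * sin v) s t (HC _ P1 P2)) as [C1 C2];
    [apply continuity_2d_pt_mult; [apply continuity_2d_pt_id1 | auto]..|].
  apply (continuity_2d_pt_ext (fun u v =>
    Re (G' (u * cos v, u * sin v)) * cos v
    - Im (G' (u * cos v, u * sin v)) * sin v)).
  - intros u v; unfold W; rewrite re_mult; reflexivity.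
  - apply continuity_2d_pt_minus; apply continuity_2d_pt_mult; auto. }
assert (Hloc : forall s, 0 < s < 1 -> locally s (fun u => 0 < u < 1)).
{ intros s Hs; apply (locally_interval _ s 0 1); simpl; try lra.
  intros y H1 H2; lra. }
assert (HI : forall s, 0 < s < 1 -> ex_RInt (U s) 0 (2 * PI)).
{ intros s Hs; apply (ex_RInt_continuous (V := R_CompleteNormedModule)).
  intros t _; apply (ex_derive_continuous (V := R_NormedModule)), DT, Hs. }
set (phi := fun s => RInt (U s) 0 (2 * PI)).
assert (Dphi : forall s, 0 < s < 1 -> is_derive phi s 0).
{ intros s Hs.
  (* The integrand is the angular derivative of Im G, which returns to its initial value after a
     full turn. *)
  assert (HW0 : is_RInt (fun t => s * W s t) 0 (2 * PI) 0).
  { replace 0 with (minus (Im (G (s * cos (2 * PI), s * sin (2 * PI))))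
      (Im (G (s * cos 0, s * sin 0)))) at 2.
    - apply (is_RInt_derive (V := R_CompleteNormedModule)
        (fun v => Im (G (s * cos v, s * sin v)))).
      + intros t _; apply DT, Hs.
      + intros t _; apply (continuous_mult (K := R_AbsRing));
          [apply continuous_const | apply continuity_2d_pt_slice, CW, Hs].
    - rewrite cos_2PI, sin_2PI, cos_0, sin_0; exact (Rplus_opp_r _). }
  assert (HW : is_RInt (W s) 0 (2 * PI) (/ s * 0)).
  { apply (is_RInt_scal _ _ _ (/ s)) in HW0.
    eapply is_RInt_ext; [|exact HW0].
    intros t _; change (/ s * (s * W s t) = W s t); field; lra. }
  rewrite Rmult_0_r in HW.
  replace 0 with (RInt (fun t => Derive (fun u => U u t) s) 0 (2 * PI)).
  - apply is_derive_RInt_param.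
    + generalize (Hloc s Hs); apply filter_imp; intros u Hu t _.
      exists (W u t); apply DU, Hu.
    + intros t _; apply (continuity_2d_pt_ext_loc W); [|apply CW, Hs].
      destruct (Hloc s Hs) as [d Hd]; exists d; intros u v Hu _.
      symmetry; apply is_derive_unique, DU, Hd, Hu.
    + generalize (Hloc s Hs); apply filter_imp; exact HI.
  - transitivity (RInt (W s) 0 (2 * PI));
      [apply RInt_ext; intros t _; apply is_derive_unique, DU, Hs|].
    apply is_RInt_unique, HW. }
(* If Re L exceeded M, then Re G would exceed M on a small circle, and so would its mean; but that
   mean equals the one over the circle of radius r. *)
apply Rnot_lt_le; intros Hlt.
destruct (HL (Re L - M)) as [d [Hd1 Hd2]]; [lra|].
set (s := Rmin (d / 2) (r / 2)).
assert (Hs : 0 < s) by (apply Rmin_glb_lt; lra).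
assert (Hsd : s <= d / 2) by apply Rmin_l.
assert (Hsr : s <= r / 2) by apply Rmin_r.
assert (Ephi : phi s = phi r).
{ apply (eq_is_derive (V := R_NormedModule)); [|lra].
  intros t Ht; apply Dphi; lra. }
pose proof PI_RGT_0 as HPI.
assert (Hconst : forall c, RInt (fun _ => c) 0 (2 * PI) = 2 * PI * c).
{ intros c; rewrite RInt_const; change ((2 * PI - 0) * c = 2 * PI * c); ring. }
assert (U1 : phi r <= 2 * PI * M).
{ rewrite <- Hconst; apply RInt_le;
    [lra | apply HI; lra | apply ex_RInt_const|].
  intros t _; apply HM, Cmod_polar; lra. }
assert (U2 : 2 * PI * M < phi s).
{ rewrite <- Hconst; apply RInt_lt; [lra | | |].
  - intros t _; apply (ex_derive_continuous (V := R_NormedModule)), DT; lra.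
  - intros t _; apply continuous_const.
  - intros t _; destruct (Hpt s t ltac:(lra)) as [_ P2].
    specialize (Hd2 _ P2); rewrite Cmod_polar in Hd2 by lra.
    specialize (Hd2 ltac:(lra)).
    match type of Hd2 with Cmod ?c < _ => pose proof (re_le_Cmod c) as H1 end.
    rewrite Cmod_minus_sym in Hd2.
    match type of Hd2 with Cmod ?c < _ => pose proof (re_le_Cmod c) as H2 end.
    pose proof (Rle_abs (Re (L - G (s * cos t, s * sin t)))) as H3.
    unfold Cminus in H2, H3, Hd2; rewrite re_plus, re_opp in H2, H3.
    unfold U; lra. }
lra.
Qed.

(** * The second coefficient of a Schwarz function *)

(* With [h = w/z], [F = h (1 + beta z)] and [B] the linear coefficient of [F],
   this is Bessel's inequality [|c1|^2 + r^2 |B|^2 <= mean |F|^2] on [|z| = r],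
   combined with [|F| <= |1 + beta z| / r].  The function [G] below is arranged
   so that [Re G] is at most a constant on the circle precisely because
   [|F - c1 - B z|^2 >= 0]. *)
Lemma bessel_circle (w k k' : C -> C) (c1 beta : C) (r : R) :
  (forall z, in_disk z -> Cmod (w z) < 1) ->
  (forall z, in_disk z -> w z = (z * (c1 + z * k z))%C) ->
  Ccontinuous k 0 ->
  (forall z, in_disk z -> z <> 0 -> is_Cderive k z (k' z)) ->
  (forall z, in_disk z -> z <> 0 -> Ccontinuous k' z) ->
  0 < r < 1 ->
  Cmod c1 ^ 2 + r ^ 2 * Cmod (k 0 + beta * c1) ^ 2
  <= / r ^ 2 + Cmod beta ^ 2.
Proof.
intros w_lt_1 w_expand k_cont_0 k_deriv k'_cont Hr.
set (B := (k 0 + beta * c1)%C).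
(* G is A F + D (F - c1) / z + E z, with the quotient written out so as to be regular at 0. On the
   circle r^2 / z is the conjugate of z, so A and D produce the mixed terms of |F - c1 - B z|^2,
   while E removes the term 2 Re(beta z) / r^2 coming from |1 + beta z|^2 / r^2. *)
set (A := (2 * Cconj c1)%C); set (D := (2 * (r * r)%R * Cconj B)%C).
set (E := (- (2 * beta / (r * r)%R))%C).
set (G := fun z => (A * ((c1 + z * k z) * (1 + beta * z))
   + D * (k z + beta * (c1 + z * k z)) + E * z)%C).
set (G' := fun z => (A * ((k z + z * k' z) * (1 + beta * z)
     + (c1 + z * k z) * beta)
   + D * (k' z + beta * (k z + z * k' z)) + E)%C).
set (M := / r ^ 2 + Cmod beta ^ 2 + Cmod c1 ^ 2 + r ^ 2 * Cmod B ^ 2).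
assert (Hr2 : 0 < r * r) by nra.
assert (Hrr : RtoC (r * r)%R <> 0) by (intros K; apply RtoC_inj in K; lra).
assert (Hle : Re (G 0) <= M).
{ apply (Re_limit_le_circle G G' (G 0) M r Hr).
  - intros z Hz Hz0; specialize (k_deriv z Hz Hz0).
    eapply is_Cderive_eq.
    + unfold G.
      Cderive_rules.
    + unfold G'; simpl; ring.
  - intros z Hz Hz0; specialize (k'_cont z Hz Hz0).
    specialize (k_deriv z Hz Hz0); apply is_Cderive_continuous in k_deriv.
    unfold G'.
    Ccontinuous_rules.
  - assert (HG : Ccontinuous G 0).
    { unfold G; Ccontinuous_rules. }
    rewrite Ccontinuous_eps in HG; intros eps Heps.
    destruct (HG eps Heps) as [d [Hd1 Hd2]]; exists d; split; [exact Hd1|].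
    intros z _ Hz; apply Hd2; replace (z - 0)%C with z by ring; exact Hz.
  - intros z Hz.
    assert (Hzd : in_disk z) by (unfold in_disk; lra).
    pose proof (w_lt_1 z Hzd) as Hw; rewrite (w_expand z Hzd) in Hw.
    set (h := (c1 + z * k z)%C) in *; set (F := (h * (1 + beta * z))%C).
    assert (Hzz : (z * Cconj z)%C = RtoC (r * r)).
    { rewrite <- Cmod2_conj, Hz; f_equal; ring. }
    assert (EG : G z = (A * F + 2 * Cconj B * ((F - c1) * Cconj z) + E * z)%C).
    { unfold G, D; fold h; fold F; rewrite <- Hzz.
      replace (F - c1)%C with (z * (k z + beta * h))%C
        by (unfold F, h; ring).
      ring. }
    assert (HF : Cmod F ^ 2 * r ^ 2 <= Cmod (1 + beta * z) ^ 2).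
    { unfold F; rewrite Cmod_mult in *; rewrite Hz in Hw.
      pose proof (Cmod_ge_0 h); pose proof (Cmod_ge_0 (1 + beta * z)).
      replace ((Cmod h * Cmod (1 + beta * z)) ^ 2 * r ^ 2)
        with ((r * Cmod h) ^ 2 * Cmod (1 + beta * z) ^ 2) by ring.
      rewrite <- (Rmult_1_l (Cmod (1 + beta * z) ^ 2)) at 2.
      apply Rmult_le_compat_r; [apply pow2_ge_0|].
      rewrite <- (pow1 2); apply pow_incr; nra. }
    assert (EE : Re (E * z) = - (2 * Re (beta * z) / r ^ 2)).
    { replace (E * z)%C with (RtoC (- (2 / r ^ 2)) * (beta * z))%C.
      - rewrite re_scal_l; field; lra.
      - unfold E; rewrite RtoC_opp, RtoC_div by nra.
        replace (r ^ 2) with (r * r) by ring; field; exact Hrr. }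
    assert (HF' : Cmod F ^ 2 <= / r ^ 2 + Cmod beta ^ 2
       + 2 * Re (beta * z) / r ^ 2).
    { assert (E1 : Cmod (1 + beta * z) ^ 2
        = 1 + Cmod beta ^ 2 * r ^ 2 + 2 * Re (beta * z)).
      { rewrite <- Hz, !Cmod2_alt, re_plus, im_plus, re_RtoC, im_RtoC,
          re_mult, im_mult; ring. }
      rewrite E1 in HF.
      replace (/ r ^ 2 + Cmod beta ^ 2 + 2 * Re (beta * z) / r ^ 2)
        with ((1 + Cmod beta ^ 2 * r ^ 2 + 2 * Re (beta * z)) / r ^ 2)
        by (field; lra).
      apply (Rle_div_r _ _ (r ^ 2)); [nra | exact HF]. }
    rewrite EG, !re_plus, EE; unfold M.
    assert (HS := pow2_ge_0 (Cmod (F - c1 - B * z))).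
    assert (E2 : Re (A * F) + Re (2 * Cconj B * ((F - c1) * Cconj z))
      = Cmod F ^ 2 + Cmod c1 ^ 2 + r ^ 2 * Cmod B ^ 2
        - Cmod (F - c1 - B * z) ^ 2).
    { rewrite <- Hz, !Cmod2_alt; unfold A.
      clearbody F; destruct F as [f1 f2], c1 as [p q], B as [b1 b2],
        z as [x y]; unfold Re, Im; simpl; ring. }
    lra. }
(* The centre value carries each square twice and [M] contains it once, which leaves the inequality
   sought. *)
assert (EG0 : Re (G 0) = 2 * Cmod c1 ^ 2 + 2 * (r ^ 2 * Cmod B ^ 2)).
{ replace (G 0) with (A * c1 + D * B)%C by (unfold G, B; ring).
  rewrite !Cmod2_alt; unfold A, D; clearbody B.
  destruct c1 as [p q], B as [b1 b2]; unfold Re, Im; simpl; ring. }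
unfold M in Hle; lra.
Qed.

(** Letting r tend to 1 in the circle inequality leaves a family of inequalities in beta; the phase
    and size of beta are then chosen to make the two parts of k(0) + beta c1 add up. *)
Lemma schwarz_second_coef (w k k' : C -> C) (c1 : C) :
  (forall z, in_disk z -> Cmod (w z) < 1) ->
  (forall z, in_disk z -> w z = (z * (c1 + z * k z))%C) ->
  Ccontinuous k 0 ->
  (forall z, in_disk z -> z <> 0 -> is_Cderive k z (k' z)) ->
  (forall z, in_disk z -> z <> 0 -> Ccontinuous k' z) ->
  Cmod (k 0) <= 1 - Cmod c1 ^ 2.
Proof.
intros w_lt_1 w_expand k_cont_0 k_deriv k'_cont.
assert (H : forall beta, Cmod c1 ^ 2 + Cmod (k 0 + beta * c1) ^ 2
  <= 1 + Cmod beta ^ 2).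
{ intros beta; pose proof (fun r => bessel_circle w k k' c1 beta r
    w_lt_1 w_expand k_cont_0 k_deriv k'_cont) as K.
  set (a := Cmod c1 ^ 2) in *; set (b := Cmod (k 0 + beta * c1) ^ 2) in *.
  set (e := Cmod beta ^ 2) in *.
  assert (Ha : 0 <= a) by apply pow2_ge_0.
  assert (Hb : 0 <= b) by apply pow2_ge_0.
  assert (He : 0 <= e) by apply pow2_ge_0.
  assert (K' : forall x, 0 < x < 1 -> a * x + b * x ^ 2 <= 1 + e * x).
  { intros x Hx.
    specialize (K (sqrt x)).
    assert (Hs : 0 < sqrt x < 1).
    { split; [apply sqrt_lt_R0; lra|].
      rewrite <- sqrt_1; apply sqrt_lt_1; lra. }
    specialize (K Hs); rewrite pow2_sqrt in K by lra.
    apply (Rmult_le_compat_r x) in K; [|lra].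
    rewrite (Rmult_plus_distr_r (/ x)), Rinv_l in K by lra.
    simpl; nra. }
  apply Rnot_lt_le; intros Hlt.
  (* Let d be the supposed excess at x = 1, where x stands for r^2. Moving to x = 1 - t costs at
     most s t, so t = d / (2 s) still leaves a violation of d / 2. *)
  set (s := a + 2 * b + e + 1).
  set (d := a + b - 1 - e) in *.
  assert (Hd : 0 < d) by (unfold d; lra).
  specialize (K' (1 - d / (2 * s))).
  assert (Hs : 0 < s) by (unfold s; lra).
  assert (Hds : d < s) by (unfold d, s; lra).
  set (t := d / (2 * s)) in *.
  assert (Ht : t * (2 * s) = d) by (unfold t; field; lra).
  assert (0 < t) by (apply Rdiv_lt_0_compat; lra).
  assert (t < 1) by nra.
  assert (t * s = d / 2) by lra.
  specialize (K' ltac:(lra)).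
  assert (a * t + 2 * b * t - b * t * t - e * t <= s * t)
    by (unfold s; nra).
  unfold d in *; nra. }
destruct (Ceq_dec (k 0) 0) as [E|Hk].
- specialize (H 0); rewrite Cmod_0 in H; rewrite E in *; rewrite Cmod_0.
  pose proof (pow2_ge_0 (Cmod (0 + 0 * c1))); simpl in *; lra.
- destruct (Cmod_div_unit (k 0) Hk) as [U1 U2].
  set (u := (Cconj (k 0) / Cmod (k 0))%C) in *.
  assert (Hu : (Cconj u * u)%C = RtoC 1).
  { rewrite Cmult_comm, <- Cmod2_conj, U1; f_equal; ring. }
  assert (Ek : (k 0 = Cconj u * Cmod (k 0))%C).
  { rewrite <- U2, Cmult_assoc, Hu; ring. }
  (* This beta has modulus |c1|, and beta c1 is |c1|^2 times the phase of k(0). Hence |k(0) + beta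
     c1| = |k(0)| + |c1|^2, and the inequality becomes (|k(0)| + |c1|^2)^2 <= 1. *)
  specialize (H (Cconj u * Cconj c1)%C).
  replace (k 0 + Cconj u * Cconj c1 * c1)%C
    with (Cconj u * RtoC (Cmod (k 0) + Cmod c1 ^ 2))%C in H.
  2: { rewrite Ek at 2; rewrite RtoC_plus, Cmod2_conj; ring. }
  rewrite !Cmod_mult, !Cmod_conj, U1, !Rmult_1_l, Cmod_R, Rabs_pos_eq in H.
  2: { pose proof (Cmod_ge_0 (k 0)); pose proof (pow2_ge_0 (Cmod c1)); lra. }
  pose proof (Cmod_ge_0 (k 0)); pose proof (pow2_ge_0 (Cmod c1)).
  assert ((Cmod (k 0) + Cmod c1 ^ 2) ^ 2 <= 1) by lra.
  nra.
Qed.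

(** * Coefficients of functions in [class_S_AP] *)

(** Stands in for one step of a Taylor expansion: it is continuous at 0 as soon as f has derivative
    l there. *)
Definition slope_0 (f : C -> C) (l z : C) : C :=
  if Ceq_dec z 0 then l else ((f z - f 0) / z)%C.

Lemma slope_0_0 (f : C -> C) (l : C) : slope_0 f l 0 = l.
Proof. unfold slope_0; destruct (Ceq_dec 0 0); [reflexivity | tauto]. Qed.

Lemma slope_0_eq (f : C -> C) (l z : C) : f z = (f 0 + z * slope_0 f l z)%C.
Proof.
unfold slope_0; destruct (Ceq_dec z 0) as [->|Hz]; [ring | field; exact Hz].
Qed.

Lemma Ccontinuous_slope_0 (f : C -> C) (l : C) :
  is_Cderive f 0 l -> Ccontinuous (slope_0 f l) 0.
Proof.
rewrite is_Cderive_eps, Ccontinuous_eps; intros H eps Heps.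
destruct (H (eps / 2)) as [d [Hd1 Hd2]]; [lra|].
exists d; split; [exact Hd1|]; intros y Hy; rewrite slope_0_0.
destruct (Ceq_dec y 0) as [->|Hy0].
{ rewrite slope_0_0; replace (l - l)%C with (RtoC 0) by ring.
  rewrite Cmod_0; exact Heps. }
specialize (Hd2 y Hy); rewrite (slope_0_eq f l y) in Hd2.
replace (f 0 + y * slope_0 f l y - f 0 - l * (y - 0))%C
  with ((slope_0 f l y - l) * y)%C in Hd2 by ring.
replace (y - 0)%C with y in Hd2 by ring; rewrite Cmod_mult in Hd2.
apply Rle_lt_trans with (eps / 2); [|lra].
apply Rmult_le_reg_r with (Cmod y); [apply Cmod_gt_0; exact Hy0 | exact Hd2].
Qed.

(** With f = z g the quotient z f'/f becomes 1 + z g'/g, which is regular at 0. The series of [g] is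
    1 + a_2 z + a_3 z^2 + ... *)
Lemma expansion_factor (f : C -> C) (a : nat -> C) : expansion f a ->
  exists g, has_pseries g (fun n => if n =? 0 then RtoC 1 else a (S n)) /\
    forall z, in_disk z -> f z = (z * g z)%C.
Proof.
intros Ha; set (b := fun n => if n =? 0 then RtoC 1 else a (S n)).
assert (Hb : tame b).
{ intros r Hr.
  destruct (Cseries_terms_bounded _ _ (Ha r (in_disk_RtoC r Hr))) as [M HM].
  assert (HM0 : 0 <= M)
    by (eapply Rle_trans; [apply Cmod_ge_0 | apply (HM 0%nat)]).
  assert (HMr : 0 <= M / r) by (apply Rle_div_r; lra).
  exists (1 + M / r); intros [|n]; unfold b; cbn [Nat.eqb].
  - rewrite Cmod_1; simpl; lra.
  - specialize (HM n); replace (n + 2)%nat with (S (S n)) in HM by lia.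
    rewrite Cmod_mult, Cmod_pow, Cmod_R, Rabs_pos_eq in HM by lra.
    cut (Cmod (a (S (S n))) * r ^ S n <= M / r); [lra|].
    apply (Rle_div_r _ _ r); [lra|].
    eapply Rle_trans; [|exact HM]; simpl; right; ring. }
destruct (tame_pseries b Hb) as [g Hg]; exists g; split; [exact Hg|].
intros z Hz.
pose proof (is_Cseries_scal z _ _ (proj1 (is_Cseries_S _ _) (Hg z Hz))) as H.
assert (E : (f z - z = z * (g z - b 0%nat * z ^ 0))%C).
{ apply (is_Cseries_unique _ _ _ (Ha z Hz)).
  eapply is_Cseries_ext; [|exact H]; intros n; unfold b; cbn [Nat.eqb].
  replace (n + 2)%nat with (S (S n)) by lia; rewrite !Cpow_S; ring. }
replace (f z) with (f z - z + z)%C by ring; rewrite E; unfold b; simpl; ring.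
Qed.

Lemma psi_AP_second_order : exists e,
  (forall v, in_disk v -> psi_AP v = (1 + 3 / 2 * v + v * v * e v)%C) /\
  e 0 = RtoC (7 / 8) /\ Ccontinuous e 0.
Proof.
destruct psi_AP_pseries as (b & Hb & B0 & B1 & B2 & _).
destruct (has_pseries_S_ex _ _ Hb) as (e1 & He1 & E1).
destruct (has_pseries_S_ex _ _ He1) as (e2 & He2 & E2).
exists e2; split; [|split].
- intros v Hv; rewrite E1, E2, B0, B1 by exact Hv.
  rewrite RtoC_div by lra; ring.
- rewrite (has_pseries_0 _ _ He2); exact B2.
- destruct (has_pseries_derive_ex _ _ He2) as (e3 & _ & D).
  apply (is_Cderive_continuous _ _ (e3 0)), D, in_disk_0.
Qed.

(** Multiplied by 2 (1 + v) it becomes 3 + 2 v, whose real part exceeds 1. It follows that w' can be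
    solved for in the differentiated subordination. *)
Lemma psi_log_deriv_neq_0 (v : C) : in_disk v -> psi_log_deriv v <> 0.
Proof.
intros Hv E; pose proof (one_plus_neq_0 v Hv) as H1.
assert (H : (2 * (1 + v) * psi_log_deriv v)%C = (3 + 2 * v)%C).
{ unfold psi_log_deriv; field; exact H1. }
rewrite E, Cmult_0_r in H.
apply (f_equal Re) in H; rewrite re_plus, re_scal_l, !re_RtoC in H.
unfold in_disk in Hv; pose proof (re_le_Cmod v) as H2.
apply Rabs_le_between in H2; lra.
Qed.

(* Differentiating [psi (w z) = z f'(z) / f(z)] expresses [w'] through [f''],
   so [w'] is continuous; [w = z (c1 + z k)] by comparing second-order
   expansions on both sides. *)
Lemma class_S_AP_coefficients (f : C -> C) (a : nat -> C) :
  class_S_AP f -> expansion f a ->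
  exists c1 c2, Cmod c2 <= 1 - Cmod c1 ^ 2 /\
    a 2%nat = (3 / 2 * c1)%C /\ a 3%nat = (25 / 16 * c1 ^ 2 + 3 / 4 * c2)%C.
Proof.
intros [[_ [_ _]] [Hnz [w [[Hw [Hw0 Hw1]] Hsub]]]] Ha.
destruct (expansion_factor f a Ha) as (g & Hg & Hfg).
destruct (has_pseries_derive_ex _ _ Hg) as (g1 & Hg1 & D0).
destruct (has_pseries_derive_ex _ _ Hg1) as (g2 & Hg2 & D1).
destruct (has_pseries_derive_ex _ _ Hg2) as (g3 & _ & D2).
assert (G0 : g 0 = RtoC 1) by (rewrite (has_pseries_0 _ _ Hg); reflexivity).
assert (G1 : g1 0 = a 2%nat).
{ rewrite (has_pseries_0 _ _ Hg1); unfold deriv_coef; simpl; ring. }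
assert (G2 : g2 0 = (2 * a 3%nat)%C).
{ rewrite (has_pseries_0 _ _ Hg2); unfold deriv_coef; simpl.
  rewrite RtoC_plus; ring. }
assert (Hgnz : forall z, in_disk z -> g z <> 0).
{ intros z Hz E; destruct (Ceq_dec z 0) as [->|Hz0].
  - rewrite G0 in E; apply RtoC_inj in E; lra.
  - apply (Hnz z Hz Hz0); rewrite Hfg, E by exact Hz; ring. }
set (p := fun z => (g1 z * / g z)%C).
set (p1 := fun z => (g2 z * / g z + g1 z * (- / (g z * g z) * g1 z))%C).
assert (Dp : forall z, in_disk z -> is_Cderive p z (p1 z)).
{ intros z Hz; specialize (D0 z Hz); specialize (D1 z Hz).
  unfold p, p1; Cderive_rules; exact (Hgnz z Hz). }
assert (Hpsi : forall z, in_disk z -> psi_AP (w z) = (1 + z * p z)%C).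
{ intros z Hz; rewrite <- Hsub by exact Hz; unfold starlike_quotient.
  destruct (Ceq_dec z 0) as [->|Hz0]; [ring|].
  assert (E : C_derive f z = (g z + z * g1 z)%C).
  { apply is_C_derive_unique; destruct (in_disk_open z Hz) as (r & Hr & Hball).
    apply (is_Cderive_ext_loc (fun y => y * g y)%C f z _ r Hr).
    - intros y Hy; symmetry; apply Hfg, Hball, Hy.
    - specialize (D0 z Hz); eapply is_Cderive_eq; [Cderive_rules | ring]. }
  rewrite E, Hfg by exact Hz; unfold p; field; auto. }
(* The solution for w' of psi'(w) w' = p + z p', with psi'(w) written as the logarithmic derivative
   at w times psi(w) = 1 + z p. *)
set (w1 := fun z => ((p z + z * p1 z)
  * / ((1 + / 2 * / (1 + w z)) * (1 + z * p z)))%C).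
assert (Hqnz : forall z, in_disk z -> (1 + z * p z)%C <> 0).
{ intros z Hz; rewrite <- Hpsi by exact Hz.
  destruct psi_AP_pseries as (b & _ & _ & _ & _ & H); apply H, Hw1, Hz. }
assert (Hlnz : forall z, in_disk z -> (1 + / 2 * / (1 + w z))%C <> 0).
{ intros z Hz; apply (psi_log_deriv_neq_0 (w z)), Hw1, Hz. }
assert (Dw : forall z, in_disk z -> is_Cderive w z (w1 z)).
{ intros z Hz.
  assert (exists l : C, is_Cderive w z l) as [l Hl] by exact (Hw z Hz).
  assert (E : (psi_log_deriv (w z) * psi_AP (w z) * l = p z + z * p1 z)%C).
  { apply (is_Cderive_unique (fun y => psi_AP (w y)) z).
    - apply (is_Cderive_comp w psi_AP); [exact Hl|].
      apply is_Cderive_psi_AP, Hw1, Hz.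
    - destruct (in_disk_open z Hz) as (r & Hr & Hball).
      apply (is_Cderive_ext_loc (fun y => 1 + y * p y)%C _ z _ r Hr).
      + intros y Hy; symmetry; apply Hpsi, Hball, Hy.
      + specialize (Dp z Hz); eapply is_Cderive_eq; [Cderive_rules | ring]. }
  replace (w1 z) with l; [exact Hl|].
  rewrite Hpsi in E by exact Hz; unfold w1; rewrite <- E.
  pose proof (Hqnz z Hz); pose proof (Hlnz z Hz); unfold psi_log_deriv.
  set (X := (1 + z * p z)%C) in *.
  set (Y := (1 + / 2 * / (1 + w z))%C) in *.
  field; split; assumption. }
set (c1 := w1 0).
destruct psi_AP_second_order as (e & He & He0 & Hec).
set (h := slope_0 w c1); set (s := slope_0 p (p1 0)).
(* Put w = z h and p = a_2 + z s into 1 + 3/2 w + w^2 e(w) = 1 + z p. Cancelling z and solving the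
   linear term for h gives h = c1 + z k with this [k]. *)
set (k := fun z => (2 / 3 * (s z + - (h z * h z * e (w z))))%C).
assert (P0 : p 0 = a 2%nat).
{ unfold p; rewrite G0, G1; field. }
assert (C1 : c1 = (2 / 3 * a 2%nat)%C).
{ unfold c1, w1; rewrite P0, Hw0, !Cplus_0_r, !Cmult_0_l, !Cplus_0_r; field. }
assert (Hk : forall z, in_disk z -> w z = (z * (c1 + z * k z))%C).
{ intros z Hz; destruct (Ceq_dec z 0) as [->|Hz0]; [rewrite Hw0; ring|].
  assert (Eh : w z = (z * h z)%C)
    by (rewrite (slope_0_eq w c1 z), Hw0; unfold h; ring).
  pose proof (Hpsi z Hz) as H; rewrite (He _ (Hw1 z Hz)) in H.
  unfold k; set (E := e (w z)) in *; clearbody E.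
  rewrite Eh, (slope_0_eq p (p1 0) z), P0 in H; fold s in H.
  rewrite Eh, C1; f_equal.
  assert (H' : (z * (3 / 2 * h z + z * (h z * h z * E))
      = z * (a 2%nat + z * s z))%C).
  { apply (f_equal (fun y => y - 1)%C) in H.
    replace (z * (3 / 2 * h z + z * (h z * h z * E)))%C
      with (1 + 3 / 2 * (z * h z) + z * h z * (z * h z) * E - 1)%C by ring.
    rewrite H; ring. }
  apply (f_equal (fun y => y / z)%C) in H'.
  replace (z * (3 / 2 * h z + z * (h z * h z * E)) / z)%C
    with (3 / 2 * h z + z * (h z * h z * E))%C in H' by (field; exact Hz0).
  replace (z * (a 2%nat + z * s z) / z)%C
    with (a 2%nat + z * s z)%C in H' by (field; exact Hz0).
  replace (h z) with (2 / 3 * (3 / 2 * h z + z * (h z * h z * E)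
     - z * (h z * h z * E)))%C at 1 by field.
  rewrite H'; ring. }
assert (Hk0 : Ccontinuous k 0).
{ pose proof (Ccontinuous_slope_0 p (p1 0) (Dp 0 in_disk_0)) as S1.
  pose proof (Ccontinuous_slope_0 w c1 (Dw 0 in_disk_0)) as S2.
  assert (S3 : Ccontinuous (fun z => e (w z)) 0).
  { apply Ccontinuous_comp; [|rewrite Hw0; exact Hec].
    apply (is_Cderive_continuous w 0 (w1 0)), Dw, in_disk_0. }
  unfold k; fold s in S1; fold h in S2.
  apply (Ccontinuous_mult (fun _ => _)); [apply Ccontinuous_const|].
  apply (Ccontinuous_plus s); [exact S1|].
  apply (Ccontinuous_opp (fun z => h z * h z * e (w z))%C).
  apply (Ccontinuous_mult (fun z => h z * h z)%C); [|exact S3].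
  apply Ccontinuous_mult; exact S2. }
(* Away from 0, k = (w/z - c1) / z, and this is its derivative, left in the form produced by the
   product rule. *)
set (k' := fun z => ((w1 z * / z + w z * (- / (z * z) * 1)) * / z
  + (w z * / z + - c1) * (- / (z * z) * 1))%C).
exists c1, (k 0); split; [|split].
- apply (schwarz_second_coef w k k' c1); try assumption.
  + intros z Hz Hz0; destruct (in_disk_open z Hz) as (r & Hr & Hball).
    assert (Hm : 0 < Cmod z) by (apply Cmod_gt_0; exact Hz0).
    apply (is_Cderive_ext_loc (fun y => (w y * / y + - c1) * / y)%C k z _
      (Rmin r (Cmod z))); [apply Rmin_glb_lt; assumption| |].
    * intros y Hy.
      assert (Hyd : in_disk y)
        by (apply Hball; eapply Rlt_le_trans; [exact Hy | apply Rmin_l]).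
      assert (Hy0 : y <> 0).
      { intros ->; pose proof (Rmin_r r (Cmod z)).
        rewrite Cmod_minus_sym in Hy.
        replace (z - 0)%C with z in Hy by ring; lra. }
      rewrite Hk by exact Hyd; field; exact Hy0.
    * specialize (Dw z Hz); unfold k'; eapply is_Cderive_eq;
        [Cderive_rules; exact Hz0 | ring].
  + intros z Hz Hz0; unfold k', w1, p1, p.
    pose proof (is_Cderive_continuous _ _ _ (D0 z Hz)).
    pose proof (is_Cderive_continuous _ _ _ (D1 z Hz)).
    pose proof (is_Cderive_continuous _ _ _ (D2 z Hz)).
    pose proof (is_Cderive_continuous _ _ _ (Dw z Hz)).
    pose proof (Hgnz z Hz); pose proof (Hqnz z Hz); pose proof (Hlnz z Hz).
    pose proof (one_plus_neq_0 (w z) (Hw1 z Hz)).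
    Ccontinuous_rules; try assumption; apply Cmult_neq_0; assumption.
- rewrite C1; field.
(* Here k(0) = 2/3 (p'(0) - 7/8 c1^2) and p'(0) = 2 a_3 - a_2^2. With a_2^2 = 9/4 c1^2 this makes
   the coefficient of c1^2 in a_3 equal to (9/4 + 7/8) / 2 = 25/16. *)
- unfold k, s, h; rewrite !slope_0_0, Hw0, He0; unfold p1.
  rewrite G0, G1, G2, C1, RtoC_div by lra; field.
Qed.

(** * Extremal functions *)

(** Write psi(w(z)) = 1 + z p(z) and solve g' = p g. Then f = z g satisfies z f'/f = 1 + z p, and
    the first two steps of the recursion for g give a_2 and a_3. *)
Lemma class_S_AP_extremal (w : C -> C) (c : nat -> C) :
  schwarz_function w -> has_pseries (fun z => psi_AP (w z)) c ->
  c 0%nat = RtoC 1 ->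
  exists f a, class_S_AP f /\ expansion f a /\
    a 2%nat = c 1%nat /\ a 3%nat = ((c 1%nat * c 1%nat + c 2%nat) / 2)%C.
Proof.
intros Hw Hc c0.
destruct (has_pseries_S_ex _ _ Hc) as (p & Hp & Ep).
destruct (linear_ode p _ Hp) as (g & b & Hb & Hg & Dg & Hnz & _).
destruct (has_pseries_S_ex _ _ Hg) as (g1 & Hg1 & Eg).
assert (B0 : b 0%nat = RtoC 1) by apply Hb.
assert (G0 : g 0 = RtoC 1) by (rewrite (has_pseries_0 _ _ Hg); exact B0).
set (f := fun z => (z * g z)%C).
assert (Df : forall z, in_disk z -> is_Cderive f z (g z + z * (p z * g z))).
{ intros z Hz; specialize (Dg z Hz); unfold f.
  eapply is_Cderive_eq; [Cderive_rules | ring]. }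
(* The factor z shifts the coefficients of g by one; the value at index 0 is a filler outside the
   range of [expansion]. *)
exists f, (fun n => b (pred n)); split; [split; [split|split]|split; [|split]].
- intros z Hz; exists (g z + z * (p z * g z))%C; apply Df, Hz.
- split; [unfold f; ring|].
  rewrite (is_C_derive_unique f 0 _ (Df 0 in_disk_0)), G0; ring.
- intros z Hz Hz0; apply Cmult_neq_0; [exact Hz0 | apply Hnz, Hz].
- exists w; split; [exact Hw|]; intros z Hz; unfold starlike_quotient.
  rewrite (Ep z Hz), c0; destruct (Ceq_dec z 0) as [->|Hz0]; [ring|].
  rewrite (is_C_derive_unique f z _ (Df z Hz)); unfold f.
  field; split; [apply Hnz, Hz | exact Hz0].
- intros z Hz; unfold f; rewrite (Eg z Hz), B0.
  replace (z * (1 + z * g1 z) - z)%C with (z * z * g1 z)%C by ring.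
  eapply is_Cseries_ext; [|apply (is_Cseries_scal (z * z)), (Hg1 z Hz)].
  intros n; replace (n + 2)%nat with (S (S n)) by lia; rewrite !Cpow_S.
  simpl pred; ring.
- exact (ode_coef_1 _ _ Hb).
- exact (ode_coef_2 _ _ Hb).
Qed.

Lemma schwarz_id : schwarz_function (fun z => z).
Proof.
split; [|split; [reflexivity | intros z Hz; exact Hz]].
intros z _; exists (RtoC 1); apply is_Cderive_id.
Qed.

Lemma schwarz_sqr : schwarz_function (fun z => (z * z)%C).
Proof.
split; [|split; [ring|]].
- intros z _; eexists; apply is_Cderive_mult; apply is_Cderive_id.
- intros z Hz; unfold in_disk in Hz; rewrite Cmod_mult.
  pose proof (Cmod_ge_0 z); nra.
Qed.

(** * Maximization over |c1|, and equality for w(z) = z and w(z) = z^2 *)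

Theorem theorem6p1 :
  forall (lambda : C) (mu : R), 0 < mu ->
    (forall (f : C -> C) (a : nat -> C),
       class_S_AP f -> expansion f a ->
       F_functional lambda mu a <= U_AP lambda mu) /\
    (exists (f : C -> C) (a : nat -> C),
       class_S_AP f /\ expansion f a /\
       F_functional lambda mu a = U_AP lambda mu).
Proof.
intros lambda mu Hmu; unfold F_functional, U_AP.
set (L := (lambda - RtoC (25 / 36))%C).
assert (H25 : RtoC (25 / 36) = (25 / 36)%C)
  by (rewrite RtoC_div; [reflexivity | lra]).
split.
- intros f a Hf Ha.
  destruct (class_S_AP_coefficients f a Hf Ha) as (c1 & c2 & Hc & -> & ->).
  (* Completing the coefficient of c1^2: 25/16 - 9/4 lambda = -9/4 (lambda - 25/36). *)
  replace (25 / 16 * c1 ^ 2 + 3 / 4 * c2 - lambda * (3 / 2 * c1) ^ 2)%C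
    with (RtoC (3 / 4) * c2 + RtoC (- (9 / 4)) * (L * (c1 * c1)))%C.
  2: { unfold L; rewrite H25, RtoC_opp, !RtoC_div by lra; field. }
  replace (3 / 2 * c1)%C with (RtoC (3 / 2) * c1)%C
    by (rewrite RtoC_div; [reflexivity | lra]).
  pose proof (Cmod_triangle (RtoC (3 / 4) * c2)
    (RtoC (- (9 / 4)) * (L * (c1 * c1)))) as H.
  rewrite !Cmod_mult, !Cmod_R, (Rabs_left (- (9 / 4))),
    (Rabs_pos_eq (3 / 4)) in H by lra.
  rewrite Cmod_mult, Cmod_R, (Rabs_pos_eq (3 / 2)) by lra.
  pose proof (Cmod_ge_0 c1) as H1; pose proof (Cmod_ge_0 c2) as H2.
  pose proof (Cmod_ge_0 L) as H3.
  set (t := Cmod c1) in *; set (l := Cmod L) in *.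
  set (n := Cmod (RtoC (3 / 4) * c2 + RtoC (- (9 / 4)) * (L * (c1 * c1)))) in *.
  assert (Ht : t <= 1) by nra.
  assert (Hn : n <= 3 / 4 * (1 - t * t) + 9 / 4 * l * (t * t)) by nra.
  assert (Htt : t * t <= t) by nra.
  destruct (Rle_dec (1 / 3 + 2 * mu / 3) l) as [Hl|Hl].
  (* Here the coefficient of t^2 is nonnegative, so t^2 <= t replaces the bound by its chord on
     [0, 1]; the case condition says that the chord has nonnegative slope, so t = 1 is the worst
     value. *)
  + assert (K : n - mu * (3 / 2 * t) <= 3 / 4
       + (9 / 4 * l - 3 / 4 - 3 / 2 * mu) * t).
    { assert ((9 / 4 * l - 3 / 4) * (t * t) <= (9 / 4 * l - 3 / 4) * t)
        by (apply Rmult_le_compat_l; lra).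
      lra. }
    assert ((9 / 4 * l - 3 / 4 - 3 / 2 * mu) * t
      <= (9 / 4 * l - 3 / 4 - 3 / 2 * mu) * 1)
      by (apply Rmult_le_compat_l; lra).
    lra.
  (* Below the threshold the quadratic term is at most 3/2 mu t^2, and the subtracted term 3/2 mu t
     absorbs it. *)
  + assert ((9 / 4 * l - 3 / 4) * (t * t) <= 3 / 2 * mu * (t * t))
      by (apply Rmult_le_compat_r; nra).
    assert (3 / 2 * mu * (t * t) <= 3 / 2 * mu * t)
      by (apply Rmult_le_compat_l; lra).
    lra.
- destruct (Rle_dec (1 / 3 + 2 * mu / 3) (Cmod L)) as [Hl|Hl].
  + destruct psi_AP_pseries as (c & Hc & c0 & c1 & c2 & _).
    destruct (class_S_AP_extremal _ c schwarz_id Hc c0)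
      as (f & a & Hf & Ha & E2 & E3).
    exists f, a; split; [exact Hf|]; split; [exact Ha|].
    rewrite E2, E3, c1, c2.
    (* For w(z) = z, a_2 = 3/2 and a_3 = 25/16. *)
    replace ((RtoC (3 / 2) * RtoC (3 / 2) + RtoC (7 / 8)) / 2
      - lambda * RtoC (3 / 2) ^ 2)%C with (RtoC (- (9 / 4)) * L)%C.
    2: { unfold L; rewrite H25, RtoC_opp, !RtoC_div by lra; field. }
    rewrite Cmod_mult, !Cmod_R, Rabs_left, Rabs_pos_eq by lra; lra.
  + destruct psi_AP_sqr_pseries as (c & Hc & c0 & c1 & c2).
    destruct (class_S_AP_extremal _ c schwarz_sqr Hc c0)
      as (f & a & Hf & Ha & E2 & E3).
    exists f, a; split; [exact Hf|]; split; [exact Ha|].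
    rewrite E2, E3, c1, c2.
    (* For w(z) = z^2, a_2 = 0 and a_3 = 3/4, so neither lambda nor mu enters the value. *)
    replace ((0 * 0 + RtoC (3 / 2)) / 2 - lambda * 0 ^ 2)%C with (RtoC (3 / 4)).
    2: { rewrite !RtoC_div by lra; field. }
    rewrite !Cmod_R, Rabs_R0, Rabs_pos_eq by lra; lra.
Qed.
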